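(* There is a constant $c>0$ such that for every $n \ge 2$ and every poset $P=(S,\preceq)$ with $|S|=n$, there is a data structure representing $P$ that occupies at most $n^2/4 + c\,(n^2 \lg\lg n)/\lg n$ bits and supports precedence queries in $O(1)$ time: given two elements $a,b\in S$, it reports whether $a \preceq b$.
   Context: A poset $P=(S,\preceq)$ is a reflexive, antisymmetric, transitive binary relation $\preceq$ on a finite set $S$. Here $\lg n$ denotes $\lceil \log_2 n\rceil$. The computational model is the word-RAM with word size $\Theta(\lg n)$ bits; the elements of $S$ are identified by distinct integer labels in $\{1,\dots,n\}$, and queries are given by these labels. The space of the data structure is the number of bits it stores. *)

(* Defs.v *)
From HB Require Import structures.
From mathcomp Require Import all_boot all_order all_algebra.
From mathcomp Require Import reals.

Set Implicit Arguments.
Unset Strict Implicit.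
Unset Printing Implicit Defensive.

Definition lg (n : nat) : nat := up_log 2 n.

(** Word-RAM.  Registers are named by constants occurring in the program, so a
    program uses finitely many of them; memory is addressed indirectly.  Words
    are represented by the naturals below [2 ^ w]. *)

Inductive binop :=
  Add | Sub | Mul | Div | Mod | And | Or | Xor | Shl | Shr | CmpEq | CmpLt.

Inductive instr :=
  | Const of nat & nat               (* r_d := constant            *)
  | Op of binop & nat & nat & nat    (* r_d := r_x op r_y          *)
  | Read of nat & nat                (* r_d := mem[r_x]            *)
  | Write of nat & nat               (* mem[r_x] := r_y            *)
  | Jump of nat                      (* goto l                     *)
  | JumpIf of nat & nat              (* if r_x <> 0 then goto l    *)
  | Halt.

Definition program := seq instr.

Record state := State { pc : nat; regs : nat -> nat; mem : nat -> nat }.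

(* Sub is subtraction modulo [2 ^ w]; Div by 0 yields 0 and Mod by 0 yields x. *)
Definition eval_binop (w : nat) (o : binop) (x y : nat) : nat :=
  match o with
  | Add => (x + y) %% 2 ^ w
  | Sub => (x + 2 ^ w - y) %% 2 ^ w
  | Mul => (x * y) %% 2 ^ w
  | Div => x %/ y
  | Mod => x %% y
  | And => Nat.land x y
  | Or  => Nat.lor x y
  | Xor => Nat.lxor x y
  | Shl => (x * 2 ^ y) %% 2 ^ w
  | Shr => x %/ 2 ^ y
  | CmpEq => x == y
  | CmpLt => x < y
  end.

(* Running past the end of the program halts. *)
Definition fetch (p : program) (s : state) : instr := nth Halt p (pc s).

Definition halted (p : program) (s : state) : bool :=
  if fetch p s is Halt then true else false.

Definition step (w : nat) (p : program) (s : state) : state :=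
  let: State i r m := s in
  match fetch p s with
  | Const d v  => State i.+1 [eta r with d |-> v %% 2 ^ w] m
  | Op o d x y => State i.+1 [eta r with d |-> eval_binop w o (r x) (r y)] m
  | Read d x   => State i.+1 [eta r with d |-> m (r x)] m
  | Write x y  => State i.+1 r [eta m with r x |-> r y]
  | Jump l     => State l r m
  | JumpIf x l => State (if r x == 0 then i.+1 else l) r m
  | Halt       => s
  end.

(** The bits of a data structure, packed into consecutive [w]-bit words (least
    significant bit first), the rest of the memory being zero. *)
Definition packed (w : nat) (D : seq bool) (i : nat) : nat :=
  \sum_(j < w) nth false D (i * w + j) * 2 ^ j.

(** Registers 0 and 1 hold the query; registers 2, 3 and 4 hold the public
    parameters: number of elements, word size, and length in bits of the data
    structure.  The length matters for [n = 2]: as [lg (lg 2) = 0], only one bit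
    is allowed, and the three labelled posets need all bit strings of length at
    most 1. *)
Definition query_state (w n : nat) (D : seq bool) (a b : nat) : state :=
  State 0 (fun i => nth 0 [:: a; b; n; w; size D] i %% 2 ^ w) (packed w D).

Definition labelling (T : Type) (n : nat) (lab : T -> nat) : Prop :=
  injective lab /\ forall x, 0 < lab x <= n.

(** Within [t] steps the program halts with the answer in register 0 and the
    memory back in its initial state, so that queries can be repeated. *)
Definition supports_precedence (d : Order.disp_t) (S : finPOrderType d)
    (lab : S -> nat) (w : nat) (p : program) (t : nat) (D : seq bool) : Prop :=
  forall a b : S,
    let s := iter t (step w p) (query_state w #|S| D (lab a) (lab b)) in
    [/\ halted p s, regs s 0 = (a <= b)%O :> nat & mem s =1 packed w D].

(* Main.v *)
(** The comparability matrix of the poset is stored as the exclusive or of a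
    compressed matrix and a sparse correction matrix.

    Compressed part.  Call [b > a] short for [a] if at most [e] remaining elements
    lie strictly between them.  An element with more than [e] upper elements has
    more than [e] short ones, so either few pairs are comparable or the relation
    "short" is dense enough to contain a complete bipartite graph [A < B] with
    [#|A| = #|B| = q ~ lg n / lg lg n] (Kővári-Sós-Turán).  Let [v] be an element
    outside [A] and [B] that does not lie between an element of [A] and one of [B]:
    if [v] is below some [a], it is below all of [B]; if it is above some [b], it
    is above all of [A]; otherwise it is incomparable to all of [A] or to all of
    [B].  So [q + 2] bits describe how [v] compares to the [2 q] elements of
    [A :|: B].  Removing [A :|: B] and iterating costs about [n / 2] bits per
    element while the number of elements decreases from [n] to 0, in total
    [n^2 / 4 + O(n^2 / q)] bits.

    Sparse part.  The exceptional elements [v] and the comparable pairs that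
    remain in the end amount to [O(n^2 / (lg n)^3)] ones.  The correction matrix is
    cut into chunks of [(lg n)^2] bits; identical chunks are stored once and are
    reached through a table of pointers.

    Comparability is turned into precedence by comparing the numbers of elements
    below. *)

Require Import Defs.
From Stdlib Require PeanoNat.
From HB Require Import structures.
From mathcomp Require Import all_boot all_order all_algebra.
From mathcomp Require Import reals zify ring.
Import Order.TTheory GRing.Theory Num.Theory.

Set Implicit Arguments.
Unset Strict Implicit.
Unset Printing Implicit Defensive.

(** * Straight-line programs from expressions *)

Inductive expr :=
  | Var of nat
  | Cst of nat
  | Bin of binop & expr & expr
  | Deref of expr.

Fixpoint eval (w : nat) (m r : nat -> nat) (e : expr) : nat :=
  match e with
  | Var x => r x
  | Cst v => v %% 2 ^ w
  | Bin o e1 e2 => eval_binop w o (eval w m r e1) (eval w m r e2)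
  | Deref e1 => m (eval w m r e1)
  end.

Fixpoint vars_below (d : nat) (e : expr) : bool :=
  match e with
  | Var x => x < d
  | Cst _ => true
  | Bin _ e1 e2 => vars_below d e1 && vars_below d e2
  | Deref e1 => vars_below d e1
  end.

(** Register [d] receives the value and the registers above it are scratch, while those below [d]
    survive. A variable is copied by [Or] with itself. *)
Fixpoint compile (e : expr) (d : nat) : program :=
  match e with
  | Var x => [:: Op Or d x x]
  | Cst v => [:: Const d v]
  | Bin o e1 e2 => compile e1 d ++ compile e2 d.+1 ++ [:: Op o d d d.+1]
  | Deref e1 => compile e1 d ++ [:: Read d d]
  end.

Fixpoint compile_block (es : seq expr) (d : nat) : program :=
  if es is e :: es' then compile e d ++ compile_block es' d.+1 else [::].

Definition straight (c : instr) : bool :=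
  match c with Const _ _ | Op _ _ _ _ | Read _ _ => true | _ => false end.

Definition exec (w : nat) (m r : nat -> nat) (c : instr) : nat -> nat :=
  match c with
  | Const d v => [eta r with d |-> v %% 2 ^ w]
  | Op o d x y => [eta r with d |-> eval_binop w o (r x) (r y)]
  | Read d x => [eta r with d |-> m (r x)]
  | _ => r
  end.

Lemma iter_straight (w : nat) (m r : nat -> nat) (p : program) (i : nat) :
  all straight p -> i <= size p ->
  iter i (step w p) (State 0 r m) = State i (foldl (exec w m) r (take i p)) m.
Proof.
move=> sp; elim: i => [|i IHi] lti; first by rewrite take0.
rewrite iterS IHi ?(ltnW lti) // (take_nth Halt lti) foldl_rcons /step /fetch /=.
have: straight (nth Halt p i) by apply: (all_nthP Halt sp).
by case: (nth Halt p i).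
Qed.

Lemma compile_straight (e : expr) (d : nat) : all straight (compile e d).
Proof.
elim: e d => //= [o e1 IH1 e2 IH2 | e1 IH1] d.
  by rewrite !all_cat IH1 IH2.
by rewrite all_cat IH1.
Qed.

Lemma compile_block_straight (es : seq expr) (d : nat) :
  all straight (compile_block es d).
Proof. by elim: es d => //= e es IH d; rewrite all_cat compile_straight IH. Qed.

Lemma eval_ext (w : nat) (m r r' : nat -> nat) (e : expr) (d : nat) :
  vars_below d e -> (forall x, x < d -> r x = r' x) ->
  eval w m r e = eval w m r' e.
Proof.
move=> + rr'; elim: e => //= [o e1 IH1 e2 IH2|e1 IH1 /IH1-> //].
by case/andP=> /IH1-> /IH2->.
Qed.

Lemma vars_below_leq (d d' : nat) (e : expr) :
  d <= d' -> vars_below d e -> vars_below d' e.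
Proof.
move=> dd'; elim: e => //= [x xd|o e1 IH1 e2 IH2]; first exact: leq_trans xd dd'.
by case/andP=> /IH1-> /IH2->.
Qed.

Lemma compileP (w : nat) (m r : nat -> nat) (e : expr) (d : nat) :
  vars_below d e ->
  let r' := foldl (exec w m) r (compile e d) in
  r' d = eval w m r e /\ forall x, x < d -> r' x = r x.
Proof.
elim: e d r => [y|v|o e1 IH1 e2 IH2|e1 IH1] d r /=.
- by move=> yd; rewrite eqxx PeanoNat.Nat.lor_diag; split=> // x xd; rewrite ltn_eqF.
- by move=> _; rewrite eqxx; split=> // x xd; rewrite ltn_eqF.
- case/andP=> v1 v2; rewrite !foldl_cat /= eqxx.
  have [E1 F1] := IH1 d r v1; set r1 := foldl _ r _ in E1 F1 *.
  have [E2 F2] := IH2 d.+1 r1 (vars_below_leq (leqnSn d) v2).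
  split=> [|x xd]; last by rewrite ltn_eqF // F2 ?F1 // ltnS ltnW.
  by rewrite E2 F2 // E1 (eval_ext (r' := r) w m v2).
- move=> v1; rewrite foldl_cat /= eqxx.
  have [E1 F1] := IH1 d r v1.
  by split=> [|x xd]; [rewrite E1 | rewrite ltn_eqF // F1].
Qed.

Fixpoint block_scoped (es : seq expr) (d : nat) : bool :=
  if es is e :: es' then vars_below d e && block_scoped es' d.+1 else true.

(** Each entry reads only registers below its own, and later entries do not overwrite these. So the
    final registers satisfy all the equations at once. *)
Lemma compile_blockP (w : nat) (m r : nat -> nat) (es : seq expr) (d : nat) :
  block_scoped es d ->
  let r' := foldl (exec w m) r (compile_block es d) in
  (forall x, x < d -> r' x = r x) /\
  forall i, i < size es -> r' (d + i) = eval w m r' (nth (Cst 0) es i).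
Proof.
elim: es d r => [|e es IH] d r //= /andP[ve /IH{IH}IH].
rewrite foldl_cat; have [E1 F1] := compileP w m r ve.
set r1 := foldl _ r _ in E1 F1 *; have [F2 E2] := IH r1.
have F x : x < d -> foldl (exec w m) r1 (compile_block es d.+1) x = r x.
  by move=> xd; rewrite F2 ?F1 // ltnS ltnW.
split=> // -[|i] li /=; last by rewrite -addSnnS E2.
by rewrite addn0 F2 // E1; apply: eval_ext ve _ => x xd; rewrite F.
Qed.

(** Registers 0 to 4 hold the input, so the block starts at 5. There are no jumps: the running time
    is the length of the program. *)
Definition program_of (es : seq expr) : program :=
  rcons (compile_block es 5) (Op Or 0 (4 + size es) (4 + size es)).

Lemma program_ofP (w : nat) (m r0 : nat -> nat) (es : seq expr) :
  block_scoped es 5 -> 0 < size es ->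
  let p := program_of es in
  let s := iter (size p) (step w p) (State 0 r0 m) in
  exists r : nat -> nat,
    [/\ halted p s, Defs.mem s = m, regs s 0 = r (4 + size es),
        forall x, x < 5 -> r x = r0 x &
        forall i, i < size es -> r (5 + i) = eval w m r (nth (Cst 0) es i)].
Proof.
move=> sc ne p s; have [F E] := compile_blockP w m r0 sc.
exists (foldl (exec w m) r0 (compile_block es 5)).
rewrite /s iter_straight //; last by rewrite all_rcons /= compile_block_straight.
rewrite take_size /halted /fetch /= nth_default //; split=> //.
by rewrite foldl_rcons /= PeanoNat.Nat.lor_diag.
Qed.

(** * Bit fields *)

Definition bitval (D : seq bool) (o f : nat) : nat :=
  \sum_(j < f) nth false D (o + j) * 2 ^ j.

Lemma bitval1 (D : seq bool) (o : nat) : bitval D o 1 = nth false D o.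
Proof. by rewrite /bitval big_ord1 addn0 muln1. Qed.

Lemma bitvalD (D : seq bool) (o f g : nat) :
  bitval D o (f + g) = bitval D o f + bitval D (o + f) g * 2 ^ f.
Proof.
rewrite /bitval big_split_ord /=; congr (_ + _).
by rewrite big_distrl /=; apply: eq_bigr => j _; rewrite addnA expnD mulnAC mulnA.
Qed.

Lemma bitval_lt (D : seq bool) (o f : nat) : bitval D o f < 2 ^ f.
Proof.
elim: f => [|f IH]; first by rewrite /bitval big_ord0.
rewrite -[f.+1]addn1 bitvalD bitval1 expnD expn1.
by case: (nth _ _ _); lia.
Qed.

Lemma bitval_mod (D : seq bool) (o f g : nat) :
  f <= g -> bitval D o g %% 2 ^ f = bitval D o f.
Proof.
by move=> fg; rewrite -(subnKC fg) bitvalD addnC modnMDl modn_small ?bitval_lt.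
Qed.

Lemma bitval_div (D : seq bool) (o f g : nat) :
  f <= g -> bitval D o g %/ 2 ^ f = bitval D (o + f) (g - f).
Proof.
move=> fg; rewrite -{1}(subnKC fg) bitvalD addnC divnMDl ?expn_gt0 //.
by rewrite divn_small ?bitval_lt // addn0.
Qed.

(* The field is spread over at most two consecutive words. *)
Definition field_expr (o f : expr) : expr :=
  Bin Mod
    (Bin Add (Bin Shr (Deref (Bin Div o (Var 3))) (Bin Mod o (Var 3)))
       (Bin Shl (Deref (Bin Add (Bin Div o (Var 3)) (Cst 1)))
          (Bin Defs.Sub (Var 3) (Bin Mod o (Var 3)))))
    (Bin Shl (Cst 1) f).

Lemma eval_field (w : nat) (D : seq bool) (r : nat -> nat) (eo ef : expr)
    (o f : nat) :
  r 3 = w -> eval w (packed w D) r eo = o -> eval w (packed w D) r ef = f ->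
  o.+1 < 2 ^ w -> f < w ->
  eval w (packed w D) r (field_expr eo ef) = bitval D o f.
Proof.
move=> r3 Eo Ef ow fw; rewrite /= r3 Eo Ef.
have w0 : 0 < w by apply: leq_ltn_trans fw.
have w2 : w < 2 ^ w by rewrite ltn_expl.
have rw : o %% w < w by rewrite ltn_pmod.
have od : o %/ w <= o by apply: leq_div.
rewrite (modn_small (m := 1)); last by rewrite (leq_trans _ ow).
rewrite mul1n (modn_small (m := 2 ^ f)) ?ltn_exp2l //.
rewrite (modn_small (m := _ + 1)); last by lia.
have -> : (w + 2 ^ w - o %% w) %% 2 ^ w = w - o %% w.
  have -> : w + 2 ^ w - o %% w = w - o %% w + 2 ^ w by lia.
  by rewrite modnDr modn_small //; lia.
have P i : packed w D i = bitval D (i * w) w by [].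
rewrite !P bitval_div ?(ltnW rw) // -divn_eq.
(* Truncation to [w] bits keeps the low [o %% w] bits of the next word, exactly those missing from
   the first one. *)
have -> : (bitval D ((o %/ w + 1) * w) w * 2 ^ (w - o %% w)) %% 2 ^ w =
          bitval D (o + (w - o %% w)) (o %% w) * 2 ^ (w - o %% w).
  have -> : 2 ^ w = 2 ^ (o %% w) * 2 ^ (w - o %% w).
    by rewrite -expnD subnKC // ltnW.
  rewrite -muln_modl.
  rewrite bitval_mod ?(ltnW rw) //; congr (bitval _ _ _ * _).
  by have := divn_eq o w; rewrite mulnDl; lia.
rewrite -bitvalD subnK ?(ltnW rw) // (modn_small (d := 2 ^ w)) ?bitval_lt //.
by apply: bitval_mod; apply: ltnW.
Qed.

(** * Compression by bicliques *)

Section Bicliques.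

Variables (d : Order.disp_t) (S : finPOrderType d).
Implicit Types (U A B : {set S}) (a b v z : S) (s : seq S).

Definition upper U a : {set S} := [set b in U | (a < b)%O].

Definition between U a b : {set S} := [set z in U | (a < z < b)%O].

Definition short_upper (e : nat) U a : {set S} :=
  [set b in upper U a | #|between U a b| <= e].

Definition rich (e : nat) U : {set S} := [set a in U | e < #|upper U a|].

(* Everything strictly between [a] and a minimal non-short upper element of [a]
   is short. *)
Lemma short_upper_card (e : nat) U a :
  e < #|upper U a| -> e < #|short_upper e U a|.
Proof.
move=> ea; case: (pickP [pred b in upper U a | e < #|between U a b|]) => /=.
  move=> b0 b0P.
  pose P b := (b \in upper U a) && (e < #|between U a b|).
  have [b /andP[bU lb] bmin] := @arg_minnP _ b0 P (fun b => #|between U a b|) b0P.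
  apply: leq_trans lb _; apply/subset_leq_card/subsetP => z.
  rewrite inE => /and3P[zU az zb]; rewrite !inE zU az /= leqNgt; apply/negP => lz.
  have /bmin : P z by rewrite /P inE zU az.
  (* The elements between [a] and [z] form a proper subset of those between [a] and [b], as [z]
     itself is missing; a long [z] would contradict the minimality of [b]. *)
  rewrite leqNgt; apply/negP/negPn; apply: proper_card; apply/properP; split.
    apply/subsetP => y; rewrite !inE => /and3P[-> -> yz] /=.
    exact: lt_trans yz zb.
  by exists z; rewrite !inE ?zU ?az ?zb // ltxx !andbF.
move=> noLong; suff <- : upper U a = short_upper e U a by [].
apply/setP => b; rewrite [RHS]inE; case bU: (b \in _) => //=.
by have := noLong b; rewrite /= bU ltnNge => /negbFE->.
Qed.

(** Double counting of pairs of a rich [a] and an injective [q]-tuple [f] of short upper elements of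
    [a]. Each rich [a] has at least [e.+1 ^_ q] tuples, so some tuple is shared by [q] rich
    elements; these form [A], and the image of the tuple is [B]. *)
Lemma exists_biclique (e q : nat) U :
  0 < q -> q * #|S| ^ q <= e * (e.+1 ^_ q) -> e <= #|rich e U| -> 0 < #|S| ->
  exists A B : {set S},
    [/\ A \subset U, B \subset U, #|A| = q, #|B| = q &
        forall a b, a \in A -> b \in B -> (a < b)%O && (#|between U a b| <= e)].
Proof.
move=> q0 hq hr S0.
pose inj := [set f : {ffun 'I_q -> S} | injectiveb f].
pose common (f : {ffun 'I_q -> S}) := [set a in rich e U | f \in ffun_on (mem (short_upper e U a))].
case: (pickP [pred f in inj | q <= #|common f|]) => /= [f|none].
  rewrite inE => /andP[/injectiveP finj /card_geqP[l [lu ls lC]]].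
  exists [set x in l], [set f i | i in 'I_q].
  have lP a : a \in l -> a \in U /\ forall i, f i \in short_upper e U a.
    by move/lC; rewrite !inE => /andP[/andP[aU _] /ffun_onP h]; split.
  split.
  - by apply/subsetP => a; rewrite inE => /lP[].
  - apply/subsetP => b /imsetP[i _ ->].
    have /lP[_ /(_ i)] : nth (f i) l 0 \in l by rewrite mem_nth // ls.
    by rewrite !inE => /andP[/andP[]].
  - by rewrite cardsE (card_uniqP lu).
  - by rewrite card_imset // card_ord.
  - move=> a b; rewrite inE => /lP[_ h] /imsetP[i _ ->].
    by have := h i; rewrite !inE => /andP[/andP[_ ->] ->].
exfalso.
(* Counted by tuples, the pairs are at most [q.-1] for each tuple; counted by rich elements below,
   they are too many for that. *)
have : \sum_(a in rich e U) \sum_(f in inj | f \in ffun_on (mem (short_upper e U a))) 1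
       <= (q.-1) * #|S| ^ q.
  rewrite (exchange_big_dep (fun f => f \in inj)) /=; last first.
    by move=> a f _ /andP[].
  apply: leq_trans (_ : \sum_(f in inj) q.-1 <= _).
    apply: leq_sum => f fi; rewrite sum1dep_card.
    have := none f; rewrite /= fi /= => /negbT; rewrite -ltnNge => h.
    by rewrite -ltnS prednK.
  rewrite sum_nat_const mulnC leq_mul2l; apply/orP; right.
  by apply: leq_trans (max_card _) _; rewrite card_ffun card_ord.
apply/negP; rewrite -ltnNge.
apply: leq_trans (_ : q * #|S| ^ q <= _).
  by rewrite ltn_pmul2r ?expn_gt0 ?S0 // prednK.
apply: leq_trans hq _.
apply: leq_trans (_ : \sum_(a in rich e U) (e.+1 ^_ q) <= _).
  by rewrite sum_nat_const leq_mul2r hr orbT.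
apply: leq_sum => a; rewrite inE => /andP[_ /short_upper_card h].
rewrite sum1dep_card.
have -> : #|[set f | (f \in inj) && (f \in ffun_on (mem (short_upper e U a)))]|
   = #|short_upper e U a| ^_ q.
  have := card_inj_ffuns_on 'I_q (mem (short_upper e U a)).
  rewrite card_ord => <-; apply: eq_card => f.
  by rewrite !inE andbC.
by rewrite !ffact_prod; apply: leq_prod => i _; apply: leq_sub2r.
Qed.

(* Position [x] lies at index [x %% (2 * q)] of its group of [2 * q] positions.
   The record of a group for position [j] starts with a bit that says which half
   of the group is listed explicitly in bits [2 .. q + 1]; bit 1 is the common
   value on the other half. *)
Definition decode (q : nat) (code : nat -> nat -> nat -> bool) (x j : nat) : bool :=
  let rec := code (x %/ (2 * q)) j in
  let p := x %% (2 * q) in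
  rec (if p %/ q == rec 0 then 2 + p %% q else 1).

(** Only [j <= x] is counted, comparability being symmetric. *)
Definition mismatch (q : nat) (code : nat -> nat -> nat -> bool)
    (cmp : nat -> nat -> bool) (x : nat) : nat :=
  \sum_(j < x.+1) (cmp x j != decode q code x j).

Definition nth_cmp s (x j : nat) : bool :=
  if s is z0 :: _ then (nth z0 s x >=< nth z0 s j)%O else false.

Lemma nth_cmpE z0 s x j : x < size s -> j < size s ->
  nth_cmp s x j = (nth z0 s x >=< nth z0 s j)%O.
Proof. by case: s => //= z s xs js; rewrite !(set_nth_default z z0). Qed.

(** [first] means that [A] is listed and [B] is uniform. If [below], [v] is below all of [B]; if
    [above], it is above all of [A]: the common bit is 1. Otherwise [v] is incomparable to [B] if it
    is above some element of [A], and to [A] if not: the common bit is 0. *)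
Definition record A B v (t : nat) : bool :=
  let below := [exists a in A, (v < a)%O] in
  let above := [exists b in B, (b < v)%O] in
  let first := below || ~~ above && [exists a in A, (a < v)%O] in
  match t with
  | 0 => ~~ first
  | 1 => below || above
  | t'.+2 => (nth v (enum (if first then A else B)) t' >=< v)%O
  end.

Definition between_sets A B v : bool :=
  [exists a in A, exists b in B, (a < v < b)%O].

Lemma recordP (q : nat) A B z0 v p :
  #|A| = q -> #|B| = q -> (forall a b, a \in A -> b \in B -> (a < b)%O) ->
  v \notin A -> v \notin B -> ~~ between_sets A B v -> p < 2 * q ->
  (nth z0 (enum A ++ enum B) p >=< v)%O =
  record A B v (if p %/ q == record A B v 0 then 2 + p %% q else 1).
Proof.
move=> cA cB AB vA vB nb p2.
have q0 : 0 < q by lia.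
have nthA i : i < q -> nth z0 (enum A) i \in A.
  by move=> iq; rewrite -mem_enum mem_nth // -cardE cA.
have nthB i : i < q -> nth z0 (enum B) i \in B.
  by move=> iq; rewrite -mem_enum mem_nth // -cardE cB.
have noB a b : a \in A -> b \in B -> (a < v)%O -> (v < b)%O -> False.
  move=> aA bB av vb; move/negP: nb; apply; apply/existsP; exists a.
  by rewrite aA; apply/existsP; exists b; rewrite bB av.
rewrite nth_cat -cardE cA /record.
case: (boolP [exists a in A, (v < a)%O]) => [/existsP[a /andP[aA va]]|nbelow] /=.
  case: ltnP => pq.
    by rewrite divn_small // eqxx modn_small //= (set_nth_default z0) // -cardE cA.
  have -> : p %/ q == 0 = false by apply/negbTE; rewrite -lt0n divn_gt0.
  have bB : nth z0 (enum B) (p - q) \in B by apply: nthB; lia.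
  by rewrite /= /Order.comparable (ltW (lt_trans va (AB _ _ aA bB))) orbT.
case: (boolP [exists b in B, (b < v)%O]) => [/existsP[b /andP[bB bv]]|nabove] /=.
  case: ltnP => pq.
    by rewrite divn_small //= /Order.comparable (ltW (lt_trans (AB _ _ (nthA _ pq) bB) bv)).
  have pE : p = 1 * q + (p - q) by lia.
  have pq' : p - q < q by lia.
  rewrite {2 3}pE divnMDl // divn_small // modnMDl modn_small //=.
  by rewrite (set_nth_default z0) // -cardE cB.
have nltA a : a \in A -> ~~ (v < a)%O.
  by move=> aA; apply: contra nbelow => va; apply/existsP; exists a; rewrite aA.
have ngtB b : b \in B -> ~~ (b < v)%O.
  by move=> bB; apply: contra nabove => vb; apply/existsP; exists b; rewrite bB.
(* Comparability is reflexive, so it splits into the two strict orders only for distinct elements;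
   this is why [v] has to avoid [A] and [B]. *)
have ncmp y : y != v -> (y >=< v)%O = (y < v)%O || (v < y)%O.
  by move=> yv; rewrite /Order.comparable !le_eqVlt (eq_sym v) (negbTE yv).
case: (boolP [exists a in A, (a < v)%O]) => [/existsP[a /andP[aA av]]|nabA] /=.
  case: ltnP => pq.
    by rewrite divn_small // eqxx modn_small //= (set_nth_default z0) // -cardE cA.
  have -> : p %/ q == 0 = false by apply/negbTE; rewrite -lt0n divn_gt0.
  have bB : nth z0 (enum B) (p - q) \in B by apply: nthB; lia.
  rewrite /= ncmp; last by apply: contraNneq vB => <-.
  apply/negbTE; rewrite negb_or ngtB //=.
  by apply/negP => vb; apply: noB aA bB av vb.
case: ltnP => pq.
  rewrite divn_small //= ncmp; last by apply: contraNneq vA => <-; apply: nthA.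
  apply/negbTE; rewrite negb_or nltA ?nthA // andbT; apply: contra nabA => av.
  by apply/existsP; exists (nth z0 (enum A) p); rewrite nthA.
have pE : p = 1 * q + (p - q) by lia.
have pq' : p - q < q by lia.
rewrite {2 3}pE divnMDl // divn_small // modnMDl modn_small //=.
by rewrite (set_nth_default z0) // -cardE cB.
Qed.

(** An element that is not rich has at most [e] upper elements, and each of the at most [e] rich
    ones has at most [#|S|]. Counting both orientations doubles the bound. *)
Lemma comparable_pairs_card (e : nat) U :
  #|rich e U| <= e ->
  \sum_(u in U) \sum_(v in U) (u >=< v)%O <= 4 * e * #|S| + 2 * #|S|.
Proof.
move=> hr.
have H : \sum_(u in U) \sum_(v in U) (u <= v)%O <= 2 * e * #|S| + #|S|.
  have hu u : u \in U -> \sum_(v in U) (u <= v)%O <= #|upper U u|.+1.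
    move=> uU; rewrite (bigD1 u) //= lexx add1n ltnS.
    rewrite /upper -sum1dep_card [leqRHS]big_mkcondr [leqRHS](bigD1 u) //= ltxx add0n.
    by apply: leq_sum => v /andP[_ vu]; rewrite lt_neqAle eq_sym vu; case: (u <= v)%O.
  (* The successor accounts for [u <= u]. *)
  apply: leq_trans (_ : \sum_(u in U) (e.+1 + (u \in rich e U) * #|S|) <= _).
    apply: leq_sum => u uU; apply: leq_trans (hu u uU) _; rewrite inE uU /=.
    have : #|upper U u| <= #|S| by apply: max_card.
    move: #|upper U u| #|S| => x y xy.
    by case: (ltnP e x) => ex; rewrite ?mul1n ?mul0n; lia.
  rewrite big_split /= sum_nat_const -big_distrl /=.
  have -> : \sum_(u in U) (u \in rich e U) = #|rich e U|.
    rewrite -sum1_card [RHS]big_mkcond [LHS]big_mkcond /=; apply: eq_bigr => u _.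
    by rewrite inE; case: (u \in U) => //=; case: ltnP.
  have UT : #|U| <= #|S| by apply: max_card.
  move: UT hr; move: #|U| #|rich e U| #|S| => x y z xz ye.
  by have := leq_mul xz (leqnn e.+1); have := leq_mul ye (leqnn z); lia.
have -> : 4 * e * #|S| + 2 * #|S| = 2 * e * #|S| + #|S| + (2 * e * #|S| + #|S|).
  by move: #|S| => x; lia.
apply: leq_trans (leq_add H H); rewrite [X in _ <= X + _]exchange_big -big_split /=.
apply: leq_sum => u _; rewrite -big_split /=; apply: leq_sum => v _.
by rewrite /Order.comparable; do 2 case: (_ <= _)%O.
Qed.

(** The zero code decodes to 0 everywhere, so its mismatches are comparable pairs. *)
Lemma terminal_encoding (e q : nat) U :
  #|rich e U| <= e ->
  exists s (code : nat -> nat -> nat -> bool),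
    [/\ uniq s, s =i U &
        \sum_(x < size s) mismatch q code (nth_cmp s) x
          <= 4 * e * #|S| + 2 * #|S|].
Proof.
move=> /comparable_pairs_card hr; exists (enum U), (fun _ _ _ => false).
split; [exact: enum_uniq | exact: mem_enum | apply: leq_trans hr].
case E: (enum U) => [|z0 s']; first by rewrite big_ord0.
rewrite -E -[leqRHS]big_enum /= (big_nth z0) big_mkord; apply: leq_sum => x _.
rewrite -[leqRHS]big_enum /= (big_nth z0) big_mkord /mismatch.
rewrite (big_ord_widen _ (fun j => nth_cmp (enum U) x j != decode q _ x j : nat)
  (ltn_ord x)) big_mkcond /=.
apply: leq_sum => j _; case: ifP => // _.
by rewrite (nth_cmpE z0) // /decode; case: (_ >=< _)%O.
Qed.

(** [A] and [B] are appended as group [g], at a group boundary by the assumption on [size s], so the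
    earlier groups keep their positions and code. In each of the [2 * q] new rows, an error comes
    either from an exceptional [v], at most [e] for each of the [q * q] pairs around it, or from one
    of the at most [2 * q] columns inside the group. *)
Lemma biclique_extend (e q g : nat) U A B s (code : nat -> nat -> nat -> bool) :
  0 < q -> A \subset U -> B \subset U -> #|A| = q -> #|B| = q ->
  (forall a b, a \in A -> b \in B -> (a < b)%O && (#|between U a b| <= e)) ->
  uniq s -> s =i U :\: (A :|: B) -> size s = 2 * q * g ->
  exists s' (code' : nat -> nat -> nat -> bool),
    [/\ uniq s', s' =i U &
        \sum_(x < size s') mismatch q code' (nth_cmp s') x
          <= \sum_(x < size s) mismatch q code (nth_cmp s) x
             + 2 * q * (q * q * e + 2 * q)].
Proof.
move=> q0 AU BU cA cB AB us sU ss.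
have ltAB a b : a \in A -> b \in B -> (a < b)%O by move=> aA /(AB a b aA)/andP[].
have [z0 z0A] : exists z0, z0 \in A by apply/card_gt0P; rewrite cA.
have sX x : x < size s -> (nth z0 s x \notin A) * (nth z0 s x \notin B) * (nth z0 s x \in U).
  by move=> /(mem_nth z0); rewrite sU !inE negb_or => /andP[/andP[-> ->] ->].
pose t := enum A ++ enum B.
have st : size t = 2 * q by rewrite size_cat -!cardE cA cB; lia.
have ut : uniq t.
  rewrite cat_uniq !enum_uniq andbT /=; apply/hasPn => b; rewrite !mem_enum => bB.
  by apply/negP => bA; have := ltAB _ _ bA bB; rewrite ltxx.
pose code' i j := if i < g then code i j else record A B (nth z0 s j).
exists (s ++ t), code'; split.
- rewrite cat_uniq us ut andbT /=; apply/hasPn => x; rewrite mem_cat !mem_enum.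
  by rewrite sU !inE => ->.
- move=> x; rewrite mem_cat sU mem_cat !mem_enum !inE.
  case xA: (x \in A); first by rewrite (subsetP AU) // orbT.
  by case xB: (x \in B) => /=; [rewrite (subsetP BU) | rewrite orbF].
rewrite size_cat big_split_ord /=; apply: leq_add.
  apply: eq_leq; apply: eq_bigr => x _; apply: eq_bigr => j _.
  have xg : x %/ (2 * q) < g by rewrite ltn_divLR ?muln_gt0 // mulnC -ss.
  have js : j < size s by apply: leq_ltn_trans (ltn_ord x); rewrite -ltnS.
  rewrite /decode /code' xg !(nth_cmpE z0) ?size_cat ?ltn_addr //.
  by rewrite !nth_cat js ltn_ord.
rewrite st.
apply: leq_trans (_ : \sum_(p < 2 * q) (q * q * e + 2 * q) <= _); last first.
  by rewrite sum_nat_const card_ord.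
apply: leq_sum => p _; rewrite /mismatch -addnS big_split_ord /=; apply: leq_add.
  apply: leq_trans (_ : \sum_(j < size s) between_sets A B (nth z0 s j) <= _).
    apply: leq_sum => j _.
    have ltx : size s + p < size (s ++ t) by rewrite size_cat st ltn_add2l.
    have ltj : j < size (s ++ t) by rewrite size_cat ltn_addr.
    rewrite (nth_cmpE z0 ltx ltj) nth_cat -ltn_subRL subnn ltn0 addKn.
    rewrite nth_cat ltn_ord /decode.
    case: (boolP (between_sets _ _ _)) => [_|nb]; first exact: leq_b1.
    rewrite leqn0 eqb0 negbK.
    have -> : (size s + p) %/ (2 * q) = g.
      by rewrite ss mulnC divnMDl ?muln_gt0 // divn_small ?ltn_ord // addn0.
    have -> : (size s + p) %% (2 * q) = p.
      by rewrite ss mulnC modnMDl modn_small.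
    have [[jA jB] _] := sX j (ltn_ord j).
    by rewrite /code' ltnn (@recordP q A B z0).
  have -> : \sum_(j < size s) between_sets A B (nth z0 s j)
         = \sum_(v in s) between_sets A B v.
    by rewrite -big_uniq // (big_nth z0) big_mkord.
  apply: leq_trans (_ : \sum_(a in A) \sum_(b in B) e <= _); last first.
    by rewrite !sum_nat_const cA cB mulnA.
  (* Each exceptional [v] is charged to a pair around it; exchanging the sums then counts by
     pairs. *)
  apply: leq_trans (_ : \sum_(v in s) \sum_(a in A) \sum_(b in B) (a < v < b)%O <= _).
    apply: leq_sum => v _; case: (boolP (between_sets A B v)) => // /existsP[a].
    case/andP=> aA /existsP[b /andP[bB avb]].
    by rewrite (bigD1 a aA) /= (bigD1 b bB) /= avb.
  rewrite exchange_big /=; apply: leq_sum => a aA; rewrite exchange_big /=.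
  apply: leq_sum => b bB; have /andP[_ h] := AB a b aA bB; apply: leq_trans h.
  rewrite /between -sum1dep_card [leqRHS]big_mkcond [leqLHS]big_mkcond /=.
  apply: leq_sum => v _; rewrite sU !inE; case: (v \in U); rewrite ?andbF ?andbT //.
  by case: ifP => // _; case: (a < v < b)%O.
apply: leq_trans (_ : \sum_(j < p.+1) 1 <= _).
  by apply: leq_sum => j _; apply: leq_b1.
by rewrite sum_nat_const card_ord muln1.
Qed.

(** Induction on [g]: while at least [e] elements are rich, a biclique is removed and its group is
    appended to the encoding of the rest. Once fewer are rich, the zero code finishes, so its cost
    is paid at most once. *)
Lemma encode_set (e q g : nat) U :
  0 < q -> q * #|S| ^ q <= e * (e.+1 ^_ q) -> #|U| = 2 * q * g ->
  exists s (code : nat -> nat -> nat -> bool),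
    [/\ uniq s, s =i U &
        \sum_(x < size s) mismatch q code (nth_cmp s) x
          <= g * (2 * q * (q * q * e + 2 * q)) + (4 * e * #|S| + 2 * #|S|)].
Proof.
move=> q0 hq; elim: g U => [|g IH] U cU.
  exists [::], (fun _ _ _ => false); rewrite big_ord0; split=> // x.
  by move: cU; rewrite muln0 => /cards0_eq->; rewrite inE.
case: (leqP e #|rich e U|) => hr; last first.
  have [s [code [us sU hs]]] := terminal_encoding q (ltnW hr).
  by exists s, code; split=> //; apply: leq_trans hs _; apply: leq_addl.
have S0 : 0 < #|S|.
  by apply: leq_trans (max_card (mem U)); rewrite cU !muln_gt0 q0.
have [A [B [AU BU cA cB AB]]] := exists_biclique q0 hq hr S0.
have dAB : [disjoint A & B].
  rewrite -setI_eq0; apply/eqP/setP => x; rewrite !inE; apply/negP => /andP[xA xB].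
  by have /andP[] := AB x x xA xB; rewrite ltxx.
have cAB : #|A :|: B| = 2 * q.
  by rewrite cardsU (eqP (_ : A :&: B == set0)) ?setI_eq0 // cards0 cA cB; lia.
have cU' : #|U :\: (A :|: B)| = 2 * q * g.
  rewrite cardsD (setIidPr _) ?subUset ?AU // cU cAB mulnS; lia.
have [s [code [us sU hs]]] := IH _ cU'.
have ss : size s = 2 * q * g by rewrite -cU' (eq_card (fun x => esym (sU x))) (card_uniqP us).
have [s' [code' [us' sU' hs']]] := biclique_extend code q0 AU BU cA cB AB us sU ss.
exists s', code'; split=> //; apply: leq_trans hs' _; rewrite mulSn addnC -addnA leq_add2l.
exact: hs.
Qed.

(** The fewer than [2 * q] elements that do not fill a group are appended at the end; each costs at
    most [#|S|] errors, whatever the code says. *)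
Lemma encode_poset (e q : nat) :
  0 < q -> q * #|S| ^ q <= e * (e.+1 ^_ q) ->
  exists s (code : nat -> nat -> nat -> bool),
    [/\ uniq s, s =i S &
        \sum_(x < #|S|) mismatch q code (nth_cmp s) x
          <= #|S| * (q * q * e + 4 * q + 4 * e + 2)].
Proof.
move=> q0 hq; set n := #|S|; pose g := n %/ (2 * q).
have gn : 2 * q * g <= n by rewrite mulnC leq_trunc_div.
pose U := [set x in take (2 * q * g) (enum S)].
have cU : #|U| = 2 * q * g.
  rewrite cardsE (card_uniqP _) ?take_uniq ?enum_uniq // size_takel // -cardE.
  exact: gn.
have [s [code [us sU hs]]] := encode_set q0 hq cU.
have ss : size s = 2 * q * g by rewrite -cU (eq_card (fun x => esym (sU x))) (card_uniqP us).
have [z0 s0|nS] := pickP S; last first.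
  have n0 : n = 0 by apply: eq_card0.
  exists [::], code; rewrite -/n n0 big_ord0; split=> // x.
  by have := nS x; rewrite !inE.
pose t := enum (~: U); pose s' := s ++ t.
have us' : uniq s'.
  rewrite cat_uniq us enum_uniq andbT /=; apply/hasPn => x.
  by rewrite mem_enum inE sU.
have sS : s' =i S.
  by move=> x; rewrite mem_cat mem_enum inE sU orbN.
have ss' : size s' = n by rewrite -(card_uniqP us') (eq_card sS).
exists s', code; split=> //.
have -> : \sum_(x < n) mismatch q code (nth_cmp s') x =
   \sum_(x < size s + size t) mismatch q code (nth_cmp s') x.
  by rewrite -size_cat ss'.
have st : size t <= 2 * q.
  have : size s + size t = n by rewrite -size_cat.
  rewrite ss /g; have := divn_eq n (2 * q).
  have : n %% (2 * q) < 2 * q by rewrite ltn_pmod ?muln_gt0.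
  by rewrite mulnC; lia.
rewrite big_split_ord /=.
apply: leq_trans (_ : g * (2 * q * (q * q * e + 2 * q)) + (4 * e * n + 2 * n)
                      + 2 * q * n <= _); last first.
  have -> : g * (2 * q * (q * q * e + 2 * q)) = 2 * q * g * (q * q * e + 2 * q) by lia.
  by have := leq_mul gn (leqnn (q * q * e + 2 * q)); lia.
apply: leq_add.
  apply: leq_trans hs; apply: eq_leq; apply: eq_bigr => x _; apply: eq_bigr => j _.
  have js : j < size s by apply: leq_ltn_trans (ltn_ord x); rewrite -ltnS.
  rewrite !(nth_cmpE z0) ?size_cat ?ltn_addr //.
  by rewrite !nth_cat js ltn_ord.
apply: leq_trans (_ : \sum_(x < size t) n <= _); last first.
  by rewrite sum_nat_const card_ord leq_mul2r st orbT.
apply: leq_sum => x _; apply: leq_trans (_ : \sum_(j < (size s + x).+1) 1 <= _).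
  by apply: leq_sum => j _; apply: leq_b1.
by rewrite sum_nat_const card_ord muln1 -ss' size_cat ltn_add2l.
Qed.

End Bicliques.

(** * Layout of the data structure *)

Definition table (f N : nat) (val : nat -> nat) : seq bool :=
  mkseq (fun k => odd (val (k %/ f) %/ 2 ^ (k %% f))) (N * f).

Lemma size_table f N val : size (table f N val) = N * f.
Proof. exact: size_mkseq. Qed.

Lemma sum_bits (f v : nat) : v < 2 ^ f -> \sum_(j < f) odd (v %/ 2 ^ j) * 2 ^ j = v.
Proof.
elim: f v => [|f IH] v hv; first by rewrite big_ord0; move: hv; rewrite expn0; lia.
rewrite big_ord_recl expn0 divn1 muln1.
have hv2 : v %/ 2 < 2 ^ f by rewrite ltn_divLR // -expnSr.
rewrite (eq_bigr (fun j : 'I_f => 2 * (odd (v %/ 2 %/ 2 ^ j) * 2 ^ j))).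
  by rewrite -big_distrr /= IH // mulnC addnC -modn2 -divn_eq.
by move=> j _; rewrite lift0 expnS divnMA mulnCA.
Qed.

Definition segment (D : seq bool) (o : nat) (X : seq bool) : Prop :=
  forall i, i < size X -> nth false D (o + i) = nth false X i.

Lemma segment_cat (A X B : seq bool) : segment (A ++ X ++ B) (size A) X.
Proof. by move=> i iX; rewrite nth_cat ltnNge leq_addr /= addKn nth_cat iX. Qed.

Lemma bitval_table D o f N val i :
  segment D o (table f N val) -> i < N -> val i < 2 ^ f ->
  bitval D (o + f * i) f = val i.
Proof.
move=> hD iN hv; rewrite -[RHS](sum_bits hv); apply: eq_bigr => j _.
have f0 : 0 < f by apply: leq_ltn_trans (ltn_ord j).
have lt : f * i + j < N * f.
  apply: leq_trans (_ : i.+1 * f <= _); last by rewrite leq_mul2r iN orbT.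
  by rewrite mulSn mulnC addnC ltn_add2r.
rewrite -addnA hD ?size_table // nth_mkseq //.
by rewrite [f * i]mulnC divnMDl // modnMDl (divn_small (ltn_ord j)) (modn_small (ltn_ord j)) addn0.
Qed.

Lemma nth_flatten_const (s : nat) (C : seq (seq bool)) i t :
  all (fun c => size c == s) C -> i < size C -> t < s ->
  nth false (flatten C) (s * i + t) = nth false (nth [::] C i) t.
Proof.
elim: C i => //= c C IH [|i] /andP[/eqP cs aC] iC ts.
  by rewrite muln0 nth_cat cs ts.
by rewrite nth_cat cs mulnS -addnA ltnNge leq_addr /= addKn IH.
Qed.

Lemma size_flatten_const (s : nat) (C : seq (seq bool)) :
  all (fun c => size c == s) C -> size (flatten C) = s * size C.
Proof.
by elim: C => [|c C IH] /=; rewrite ?muln0 // => /andP[/eqP cs /IH h]; rewrite size_cat cs h mulnS.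
Qed.

(** * Records of the groups *)

(** Rows of group [i] need only columns up to the end of the group, that is [2 * q * i.+1] records
    of [q + 2] bits, and the earlier groups hold [q * i * i.+1] records. With about [n / (2 * q)]
    groups, the listed bits amount to [n ^ 2 / 4] to first order. *)
Definition records (q : nat) (code : nat -> nat -> nat -> bool) (G : nat) : seq bool :=
  flatten [seq mkseq (fun k => code i (k %/ (q + 2)) (k %% (q + 2)))
                     ((q + 2) * (2 * q * i.+1)) | i <- iota 0 G].

Lemma recordsS q code G :
  records q code G.+1 = records q code G ++
    mkseq (fun k => code G (k %/ (q + 2)) (k %% (q + 2))) ((q + 2) * (2 * q * G.+1)).
Proof. by rewrite /records -[in LHS](addn1 G) iotaD map_cat flatten_cat /= cats0. Qed.

Lemma size_records q code G : size (records q code G) = (q + 2) * (q * G * G.+1).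
Proof.
elim: G => [|G IH]; first by rewrite /records /= !muln0.
by rewrite recordsS size_cat IH size_mkseq; lia.
Qed.

Lemma record_index_lt q G i j t :
  i < G -> j < 2 * q * i.+1 -> t < q + 2 ->
  (q + 2) * (q * i * i.+1 + j) + t < (q + 2) * (q * G * G.+1).
Proof.
move=> iG ji tq; apply: leq_trans (_ : (q + 2) * (q * i * i.+1 + j).+1 <= _).
  by rewrite [leqRHS]mulnS [ltnRHS]addnC ltn_add2l.
rewrite leq_mul2l; apply/orP; right.
apply: leq_trans (_ : q * i.+1 * i.+2 <= _); first by lia.
by rewrite !leq_mul // ?ltnS.
Qed.

Lemma nth_records q code G i j t :
  i < G -> j < 2 * q * i.+1 -> t < q + 2 ->
  nth false (records q code G) ((q + 2) * (q * i * i.+1 + j) + t) = code i j t.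
Proof.
move=> iG ji tq; elim: G iG => // G IH; rewrite ltnS leq_eqVlt recordsS nth_cat size_records.
case/orP=> [/eqP <-|iG]; last by rewrite record_index_lt // IH.
rewrite mulnDr -addnA ltnNge leq_addr /= addKn nth_mkseq.
  rewrite [(q + 2) * j]mulnC.
  by rewrite divnMDl ?modnMDl ?divn_small ?modn_small ?addn0 // addn2.
apply: leq_trans (_ : (q + 2) * j.+1 <= _); last by rewrite leq_mul2l ji orbT.
by rewrite mulnS addnC ltn_add2r.
Qed.

(** * Deduplicated chunks of the correction matrix *)

Definition chunk (s : nat) (E : nat -> bool) (k : nat) : seq bool :=
  mkseq (fun t => E (s * k + t)) s.

Definition chunks (s : nat) (E : nat -> bool) (N : nat) : seq (seq bool) :=
  undup [seq chunk s E k | k <- iota 0 N].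

Lemma size_chunk s E N : all (fun c => size c == s) (chunks s E N).
Proof.
by apply/allP => c; rewrite mem_undup => /mapP[k _ ->]; rewrite size_mkseq.
Qed.

Lemma nth_chunks s E N k t : k < N -> t < s ->
  nth false (flatten (chunks s E N)) (s * index (chunk s E k) (chunks s E N) + t)
  = E (s * k + t).
Proof.
move=> kN ts.
have kc : chunk s E k \in chunks s E N.
  by rewrite mem_undup; apply: map_f; rewrite mem_iota.
rewrite nth_flatten_const ?size_chunk ?index_mem // nth_index //.
by rewrite nth_mkseq.
Qed.

Lemma size_chunks_le s E N : size (chunks s E N) <= N.
Proof. by apply: leq_trans (size_undup _) _; rewrite size_map size_iota. Qed.

(* Each chunk other than the zero chunk contains a one. *)
Lemma size_chunks s (E : pred nat) N M :
  0 < s -> (forall i, E i -> i < M) -> size (chunks s E N) <= (count E (iota 0 M)).+1.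
Proof.
move=> s0 EM; rewrite -size_filter.
set Z := filter _ _.
apply: leq_trans (_ : size (nseq s false :: [seq chunk s E (i %/ s) | i <- Z]) <= _).
  apply: uniq_leq_size; first exact: undup_uniq.
  move=> c; rewrite mem_undup => /mapP[k _ ->]; rewrite inE.
  case: (boolP (has E [seq s * k + t | t <- iota 0 s])) => [/hasP[i]|/hasPn h].
    case/mapP=> t; rewrite mem_iota add0n => /= ts -> Ei; apply/orP; right.
    apply/mapP; exists (s * k + t); first by rewrite mem_filter Ei mem_iota /= EM.
    by rewrite mulnC divnMDl // divn_small // addn0.
  apply/orP; left; apply/eqP; apply: (@eq_from_nth _ false).
    by rewrite size_mkseq size_nseq.
  move=> t; rewrite size_mkseq => ts; rewrite nth_mkseq // nth_nseq ts.
  by apply/negbTE/h/map_f; rewrite mem_iota.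
by rewrite /= size_map.
Qed.

Lemma count_iota_mul (E : pred nat) (m n : nat) :
  count E (iota 0 (m * n)) = \sum_(x < m) \sum_(j < n) E (x * n + j).
Proof.
elim: m => [|m IH]; first by rewrite big_ord0.
rewrite mulSn addnC iotaD count_cat IH big_ord_recr /=; congr (_ + _).
rewrite -sum1_count big_mkcond /= add0n -[m * n in LHS]addn0 iotaDl big_map.
rewrite -[n in iota 0 n]subn0 big_mkord; apply: eq_bigr => j _; by case: (E _).
Qed.

Section Layout.

Variables (n l q : nat) (pos rk : nat -> nat).
Variables (code : nat -> nat -> nat -> bool) (E : pred nat).

Let W := 8 * l.
Let s := l * l.
Let G := n %/ (2 * q) + 1.
Let N := n * n %/ s + 1.

Definition rank_off := 4 * W + n.+1 * l.
Definition record_off := rank_off + n.+1 * l.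
Definition pointer_off := record_off + (q + 2) * (q * G * G.+1).
Definition chunk_off := pointer_off + N * W.
Definition data_size := chunk_off + s * size (chunks s E N).

Definition pointer (k : nat) : nat :=
  chunk_off + s * index (chunk s E k) (chunks s E N).

(** Storing [q] and the offsets spares the program their computation, in particular that of
    logarithms. *)
Definition header : seq bool :=
  table W 4 (fun i => nth 0 [:: q; rank_off; record_off; pointer_off] i).

(* The padding makes the length congruent to [l] modulo [n], from which the
   query algorithm recovers [l]. *)
Definition layout : seq bool :=
  header ++ table l n.+1 pos ++ table l n.+1 rk ++ records q code G ++
  table W N pointer ++ flatten (chunks s E N) ++
  nseq ((l + data_size * n.-1) %% n) false.

Hypotheses (n3 : 3 <= n) (ln : l < n) (l2 : 2 <= l) (q0 : 0 < q) (ql : q <= l).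
Hypotheses (nl : n <= 2 ^ l).
Hypotheses (posP : forall a, pos a < n) (rkP : forall a, rk a < n).

Lemma size_layout : size layout = data_size + (l + data_size * n.-1) %% n.
Proof.
rewrite /layout /header !size_cat !size_table size_records size_nseq.
rewrite (size_flatten_const (size_chunk _ _ _)).
by rewrite /data_size /chunk_off /pointer_off /record_off /rank_off; lia.
Qed.

(** The padded length is congruent to [data_size + l + data_size * n.-1 = l + data_size * n], and
    [l < n]. *)
Lemma size_layout_mod : size layout %% n = l.
Proof.
rewrite size_layout modnDmr addnCA -mulnS prednK; last by lia.
by rewrite addnC modnMDl modn_small.
Qed.

Lemma size_layout_le : size layout <= data_size + n.
Proof. by rewrite size_layout leq_add2l ltnW // ltn_pmod //; lia. Qed.

(** This makes every address fit into [8 * l] bits. In terms of [X = 2 ^ l], all parts are bounded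
    by polynomials of degree at most 4, and [X >= 4] lets [X ^ 8] absorb the coefficients. *)
Lemma data_size_lt : data_size + n < 2 ^ W.
Proof.
rewrite /W mulnC expnM.
have : 4 <= 2 ^ l by rewrite (@leq_exp2l 2 2).
have lN : l < 2 ^ l by rewrite ltn_expl.
move: nl lN; move: (2 ^ l) => X nX lX X4.
have GX : G <= X.
  have : n %/ (2 * q) <= n %/ 2 by apply: leq_div2l; lia.
  by rewrite /G; have := divn_eq n 2; lia.
have NX : N <= 2 * X * X.
  have : n * n %/ s <= n * n by apply: leq_div.
  have : n * n <= X * X by apply: leq_mul.
  by rewrite /N; nia.
have h1 : size (chunks s E N) <= 2 * X * X by apply: leq_trans (size_chunks_le _ _ _) _.
have h2 : s * size (chunks s E N) <= X * X * (2 * X * X).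
  by apply: leq_mul => //; apply: leq_mul; apply: ltnW.
have h3 : N * (8 * l) <= 2 * X * X * (8 * X).
  by apply: leq_mul => //; lia.
have h4 : (q + 2) * (q * G * G.+1) <= (2 * X) * (X * X * (2 * X)).
  by apply: leq_mul; [lia|apply: leq_mul; [apply: leq_mul => //|]; lia].
have h5 : n.+1 * l <= 2 * X * X by apply: leq_mul; lia.
rewrite /data_size /chunk_off /pointer_off /record_off /rank_off /W.
have X2 : 4 * X <= X * X by rewrite leq_mul2r X4 orbT.
have X3 : 4 * (X * X) <= X * (X * X) by rewrite leq_mul2r X4 orbT.
have X4' : 4 * (X * (X * X)) <= X * (X * (X * X)) by rewrite leq_mul2r X4 orbT.
have X5 : 4 * (X * (X * (X * X))) <= X * (X * (X * (X * X))) by rewrite leq_mul2r X4 orbT.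
have X6 : 4 * (X * (X * (X * (X * X)))) <= X * (X * (X * (X * (X * X)))).
  by rewrite leq_mul2r X4 orbT.
have X7 : X * (X * (X * (X * (X * X)))) <= X ^ 8.
  have -> : X * (X * (X * (X * (X * X)))) = X ^ 6 by rewrite !expnS expn0 muln1.
  by apply: leq_pexp2l; lia.
lia.
Qed.

Lemma layout_header i : i < 4 ->
  bitval layout (W * i) W = nth 0 [:: q; rank_off; record_off; pointer_off] i.
Proof.
move=> i4; rewrite -[W * i]add0n; apply: (@bitval_table _ 0 W 4 (nth 0 _)) => //.
  exact: (@segment_cat [::]).
have := data_size_lt; rewrite /data_size /chunk_off /pointer_off /record_off /rank_off.
have : q <= 4 * W by rewrite /W; lia.
by case: i i4 => [|[|[|[|]]]] //= _; lia.
Qed.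

Lemma layout_pos a : a <= n -> bitval layout (4 * W + l * a) l = pos a.
Proof.
move=> an; apply: (@bitval_table _ _ _ n.+1) => //.
  rewrite -[4 * W](size_table W 4 (fun i => nth 0 [:: q; rank_off; record_off; pointer_off] i)).
  exact: segment_cat.
exact: leq_trans (posP a) nl.
Qed.

Lemma layout_rank a : a <= n -> bitval layout (rank_off + l * a) l = rk a.
Proof.
move=> an; apply: (@bitval_table _ _ _ n.+1) => //.
  rewrite /layout catA.
  have -> : rank_off = size (header ++ table l n.+1 pos) by rewrite size_cat !size_table.
  exact: segment_cat.
exact: leq_trans (rkP a) nl.
Qed.

Lemma layout_record i j t : i < G -> j < 2 * q * i.+1 -> t < q + 2 ->
  nth false layout (record_off + ((q + 2) * (q * i * i.+1 + j) + t)) = code i j t.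
Proof.
move=> iG ji tq; rewrite -(nth_records code iG ji tq).
have -> : layout = (header ++ table l n.+1 pos ++ table l n.+1 rk) ++ records q code G ++
  (table W N pointer ++ flatten (chunks s E N) ++
  nseq ((l + data_size * n.-1) %% n) false) by rewrite /layout -!catA.
have -> : record_off = size (header ++ table l n.+1 pos ++ table l n.+1 rk).
  by rewrite !size_cat !size_table /record_off /rank_off addnA.
by apply: segment_cat; rewrite size_records record_index_lt.
Qed.

Lemma pointer_le k : k < N -> pointer k + s <= data_size.
Proof.
move=> kN; rewrite /pointer /data_size -addnA leq_add2l addnC -mulnS leq_mul2l.
by rewrite index_mem mem_undup map_f ?orbT // mem_iota.
Qed.

Lemma layout_pointer k : k < N -> bitval layout (pointer_off + W * k) W = pointer k.
Proof.
move=> kN; apply: (@bitval_table _ _ _ N) => //.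
  have -> : layout = (header ++ table l n.+1 pos ++ table l n.+1 rk ++ records q code G) ++
    table W N pointer ++ (flatten (chunks s E N) ++
    nseq ((l + data_size * n.-1) %% n) false) by rewrite /layout -!catA.
  have -> : pointer_off = size (header ++ table l n.+1 pos ++ table l n.+1 rk ++ records q code G).
    by rewrite !size_cat !size_table size_records /pointer_off /record_off /rank_off !addnA.
  exact: segment_cat.
by have := pointer_le kN; have := data_size_lt; lia.
Qed.

Lemma layout_chunk k t : k < N -> t < s ->
  nth false layout (pointer k + t) = E (s * k + t).
Proof.
move=> kN ts; rewrite -(nth_chunks E kN ts) /pointer -addnA.
have -> : layout = (header ++ table l n.+1 pos ++ table l n.+1 rk ++ records q code G ++
  table W N pointer) ++ flatten (chunks s E N) ++
  nseq ((l + data_size * n.-1) %% n) false by rewrite /layout -!catA.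
have -> : chunk_off = size (header ++ table l n.+1 pos ++ table l n.+1 rk ++ records q code G ++
  table W N pointer).
  rewrite !size_cat !size_table size_records /chunk_off /pointer_off.
  by rewrite /record_off /rank_off !addnA.
apply: segment_cat; rewrite (size_flatten_const (size_chunk _ _ _)).
have := pointer_le kN; rewrite /pointer /data_size; lia.
Qed.

End Layout.

(** * The query algorithm *)

Section Evaluation.

Variables (w : nat) (m r : nat -> nat).

Lemma eval_var x v : r x = v -> eval w m r (Var x) = v. Proof. by []. Qed.

Lemma eval_cst v : v < 2 ^ w -> eval w m r (Cst v) = v.
Proof. exact: modn_small. Qed.

Lemma eval_add e1 e2 x y :
  eval w m r e1 = x -> eval w m r e2 = y -> x + y < 2 ^ w ->
  eval w m r (Bin Add e1 e2) = x + y.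
Proof. by move=> /= -> ->; apply: modn_small. Qed.

Lemma eval_mul e1 e2 x y :
  eval w m r e1 = x -> eval w m r e2 = y -> x * y < 2 ^ w ->
  eval w m r (Bin Mul e1 e2) = x * y.
Proof. by move=> /= -> ->; apply: modn_small. Qed.

Lemma eval_div e1 e2 x y :
  eval w m r e1 = x -> eval w m r e2 = y -> eval w m r (Bin Div e1 e2) = x %/ y.
Proof. by move=> /= -> ->. Qed.

Lemma eval_mod e1 e2 x y :
  eval w m r e1 = x -> eval w m r e2 = y -> eval w m r (Bin Mod e1 e2) = x %% y.
Proof. by move=> /= -> ->. Qed.

Lemma eval_eq e1 e2 x y :
  eval w m r e1 = x -> eval w m r e2 = y -> eval w m r (Bin CmpEq e1 e2) = (x == y).
Proof. by move=> /= -> ->. Qed.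

Lemma eval_lt e1 e2 x y :
  eval w m r e1 = x -> eval w m r e2 = y -> eval w m r (Bin CmpLt e1 e2) = (x < y).
Proof. by move=> /= -> ->. Qed.

End Evaluation.

Definition not_expr (e : expr) : expr := Bin CmpEq e (Cst 0).

(** A conditional without jumps. The operand not chosen is multiplied by 0, so it may have any
    value. *)
Definition select_expr (b e1 e2 : expr) : expr :=
  Bin Add (Bin Mul b e1) (Bin Mul (not_expr b) e2).

Lemma eval_not w m r e (b : bool) : 0 < w ->
  eval w m r e = b -> eval w m r (not_expr e) = ~~ b.
Proof.
by move=> w0 eb; rewrite (eval_eq eb (eval_cst _ _ (expn_gt0 2 w))); case: b {eb}.
Qed.

Lemma eval_select w m r e e1 e2 (b : bool) x y : 0 < w ->
  eval w m r e = b -> eval w m r e1 = x -> eval w m r e2 = y ->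
  (if b then x else y) < 2 ^ w ->
  eval w m r (select_expr e e1 e2) = if b then x else y.
Proof.
move=> w0 eb ex ey; rewrite /= eb ex ey mod0n.
by case: b {eb} => xy; rewrite /= mul1n mul0n mod0n ?addn0 ?add0n modn_mod modn_small.
Qed.

(* Entry [i] of the block is stored in register [5 + i].  With the notation of the
   section [Query] below: 5 [l]; 6 pointer width; 7 [q]; 8-10 offsets; 11, 12
   positions and 13, 14 ranks of the two elements; 16 [x]; 17 [j]; 21 address of
   the record; 25 compressed bit; 29 correction bit; 30 answer for [n > 2];
   33 answer for [n = 2]. *)
Definition query_block : seq expr :=
  [:: (*  5 *) Bin Mod (Var 4) (Var 2);
      (*  6 *) Bin Mul (Cst 8) (Var 5);
      (*  7 *) field_expr (Cst 0) (Var 6);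
      (*  8 *) field_expr (Var 6) (Var 6);
      (*  9 *) field_expr (Bin Mul (Var 6) (Cst 2)) (Var 6);
      (* 10 *) field_expr (Bin Mul (Var 6) (Cst 3)) (Var 6);
      (* 11 *) field_expr (Bin Add (Bin Mul (Cst 4) (Var 6)) (Bin Mul (Var 5) (Var 0))) (Var 5);
      (* 12 *) field_expr (Bin Add (Bin Mul (Cst 4) (Var 6)) (Bin Mul (Var 5) (Var 1))) (Var 5);
      (* 13 *) field_expr (Bin Add (Var 8) (Bin Mul (Var 5) (Var 0))) (Var 5);
      (* 14 *) field_expr (Bin Add (Var 8) (Bin Mul (Var 5) (Var 1))) (Var 5);
      (* 15 *) Bin CmpLt (Var 11) (Var 12);
      (* 16 *) select_expr (Var 15) (Var 12) (Var 11);
      (* 17 *) select_expr (Var 15) (Var 11) (Var 12);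
      (* 18 *) Bin Mul (Cst 2) (Var 7);
      (* 19 *) Bin Div (Var 16) (Var 18);
      (* 20 *) Bin Mod (Var 16) (Var 18);
      (* 21 *) Bin Add (Var 9) (Bin Mul (Bin Add (Var 7) (Cst 2))
                 (Bin Add (Bin Mul (Bin Mul (Var 7) (Var 19)) (Bin Add (Var 19) (Cst 1)))
                    (Var 17)));
      (* 22 *) field_expr (Var 21) (Cst 1);
      (* 23 *) Bin CmpEq (Bin Div (Var 20) (Var 7)) (Var 22);
      (* 24 *) select_expr (Var 23) (Bin Add (Cst 2) (Bin Mod (Var 20) (Var 7))) (Cst 1);
      (* 25 *) field_expr (Bin Add (Var 21) (Var 24)) (Cst 1);
      (* 26 *) Bin Add (Bin Mul (Var 16) (Var 2)) (Var 17);
      (* 27 *) Bin Mul (Var 5) (Var 5);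
      (* 28 *) field_expr (Bin Add (Var 10) (Bin Mul (Var 6) (Bin Div (Var 26) (Var 27)))) (Var 6);
      (* 29 *) field_expr (Bin Add (Var 28) (Bin Mod (Var 26) (Var 27))) (Cst 1);
      (* 30 *) Bin Mul (not_expr (Bin CmpEq (Var 25) (Var 29)))
                 (not_expr (Bin CmpLt (Var 14) (Var 13)));
      (* 31 *) Bin CmpEq (Var 0) (Var 1);
      (* 32 *) Bin Mul (Bin CmpEq (Var 4) (Cst 1))
                 (Bin CmpEq (Bin CmpLt (Var 0) (Var 1)) (Deref (Cst 0)));
      (* 33 *) select_expr (Var 31) (Cst 1) (Var 32);
      (* 34 *) select_expr (Bin CmpEq (Var 2) (Cst 2)) (Var 33) (Var 30)].

Definition query_program : program := program_of query_block.

Lemma query_programP w n D a b s :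
  s = iter (size query_program) (step w query_program) (query_state w n D a b) ->
  exists r : nat -> nat,
    [/\ halted query_program s, Defs.mem s = packed w D, regs s 0 = r 34,
        forall x, x < 5 -> r x = nth 0 [:: a; b; n; w; size D] x %% 2 ^ w &
        forall i, i < size query_block ->
          r (5 + i) = eval w (packed w D) r (nth (Cst 0) query_block i)].
Proof.
move=> ->; exact: (@program_ofP w (packed w D)
  (fun x => nth 0 [:: a; b; n; w; size D] x %% 2 ^ w) query_block).
Qed.

Ltac evaluate := repeat lazymatch goal with
  | |- eval _ _ _ (Var _) = _ => apply: eval_var
  | |- eval _ _ _ (Cst _) = _ => apply: eval_cst
  | |- eval _ _ _ (Bin Add _ _) = _ => apply: eval_add
  | |- eval _ _ _ (Bin Mul _ _) = _ => apply: eval_mul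
  | |- eval _ _ _ (Bin Div _ _) = _ => apply: eval_div
  | |- eval _ _ _ (Bin Mod _ _) = _ => apply: eval_mod
  | |- eval _ _ _ (Bin CmpEq _ _) = _ => apply: eval_eq
  | |- eval _ _ _ (Bin CmpLt _ _) = _ => apply: eval_lt
  | |- eval _ _ _ (field_expr _ _) = _ => apply: eval_field
  end.

Section Query.

Variables (n l q : nat) (pos rk : nat -> nat).
Variables (code : nat -> nat -> nat -> bool) (E : pred nat).
Hypotheses (n3 : 3 <= n) (ln : l < n) (l2 : 2 <= l) (q0 : 0 < q) (ql : q <= l).
Hypotheses (nl : n <= 2 ^ l).
Hypotheses (posP : forall a, pos a < n) (rkP : forall a, rk a < n).

Let D := layout n l q pos rk code E.

Lemma query_correct w a b s : 9 * l <= w -> a <= n -> b <= n ->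
  s = iter (size query_program) (step w query_program) (query_state w n D a b) ->
  let x := maxn (pos a) (pos b) in
  let j := minn (pos a) (pos b) in
  [/\ halted query_program s, Defs.mem s = packed w D &
      regs s 0 = (decode q code x j != E (x * n + j)) && (rk a <= rk b)].
Proof.
move=> lw an bn /query_programP[r [hs ms r0 ri re]] x j.
split=> //; rewrite {}r0 {hs ms s}.
have dlt := data_size_lt E n3 ln l2 q0 ql nl.
have sle := size_layout_le pos rk code E n3 ln l2 q0 ql nl.
(* As [l >= 2], at least two bits remain beyond the [8 * l] of an address, which leaves room for
   sums of addresses and sizes. *)
have Z4 : 4 * 2 ^ (8 * l) <= 2 ^ w.
  have -> : 4 * 2 ^ (8 * l) = 2 ^ (2 + 8 * l) by rewrite expnD.
  by rewrite leq_exp2l //; lia.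
have w0 : 0 < w by lia.
have wZ : w < 2 ^ w by rewrite ltn_expl.
have lW : 8 * l < w by lia.
move: dlt Z4 wZ; set Y := 2 ^ (8 * l); set Z := 2 ^ w => dlt Z4 wZ.
have nZ : n < Z by lia.
have r0 : r 0 = a by rewrite ri // modn_small //=; lia.
have r1 : r 1 = b by rewrite ri // modn_small //=; lia.
have r2 : r 2 = n by rewrite ri // modn_small //=.
have r3 : r 3 = w by rewrite ri // modn_small //=.
have r4 : r 4 = size D by rewrite ri // modn_small //= /D -/Z; lia.
have r5 : r 5 = l.
  rewrite (re 0 isT) [nth _ _ _]/= -[RHS](size_layout_mod pos rk code E n3 ln l2 q0 ql nl).
  by evaluate.
have o1 : rank_off n l = 4 * (8 * l) + n.+1 * l by [].
have o2 : record_off n l = rank_off n l + n.+1 * l by [].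
have o3 : record_off n l <= pointer_off n l q by rewrite leq_addr.
have o4 : pointer_off n l q <= chunk_off n l q by rewrite leq_addr.
have o5 : chunk_off n l q <= data_size n l q E by rewrite leq_addr.
have r6 : r 6 = 8 * l by rewrite (re 1 isT) [nth _ _ _]/=; evaluate => //; rewrite -/Z; lia.
have hd := layout_header pos rk code E n3 ln l2 q0 ql nl.
have r7 : r 7 = q.
  rewrite -[RHS](hd 0) // muln0 (re 2 isT) [nth _ _ _]/=.
  by evaluate => //; rewrite -/Z; lia.
have r8 : r 8 = rank_off n l.
  rewrite -[RHS](hd 1) // muln1 (re 3 isT) [nth _ _ _]/=.
  by evaluate => //; rewrite -/Z; lia.
have r9 : r 9 = record_off n l.
  rewrite -[RHS](hd 2) // (re 4 isT) [nth _ _ _]/=.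
  by evaluate => //; rewrite -/Z; lia.
have r10 : r 10 = pointer_off n l q.
  rewrite -[RHS](hd 3) // (re 5 isT) [nth _ _ _]/=.
  by evaluate => //; rewrite -/Z; lia.
have la : l * a <= n.+1 * l by rewrite mulnC leq_mul2r (leq_trans an) ?orbT.
have lb : l * b <= n.+1 * l by rewrite mulnC leq_mul2r (leq_trans bn) ?orbT.
have r11 : r 11 = pos a.
  rewrite -(layout_pos q rk code E nl posP an) (re 6 isT) [nth _ _ _]/=.
  by evaluate => //; rewrite -/Z; lia.
have r12 : r 12 = pos b.
  rewrite -(layout_pos q rk code E nl posP bn) (re 7 isT) [nth _ _ _]/=.
  by evaluate => //; rewrite -/Z; lia.
have r13 : r 13 = rk a.
  rewrite -(layout_rank q pos code E nl rkP an) (re 8 isT) [nth _ _ _]/=.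
  by evaluate => //; rewrite -/Z; lia.
have r14 : r 14 = rk b.
  rewrite -(layout_rank q pos code E nl rkP bn) (re 9 isT) [nth _ _ _]/=.
  by evaluate => //; rewrite -/Z; lia.
have pa := posP a; have pb := posP b.
have r15 : r 15 = (pos a < pos b) by rewrite (re 10 isT) [nth _ _ _]/=; evaluate.
have r16 : r 16 = x.
  rewrite (re 11 isT) [nth _ _ _]/= /x /maxn.
  by apply: eval_select; evaluate => //; case: ifP => _; rewrite -/Z; lia.
have r17 : r 17 = j.
  rewrite (re 12 isT) [nth _ _ _]/= /j /minn.
  by apply: eval_select; evaluate => //; case: ifP => _; rewrite -/Z; lia.
have xn : x < n by rewrite gtn_max pa.
have jx : j <= x by rewrite geq_min leq_max leqnn.
have r18 : r 18 = 2 * q by rewrite (re 13 isT) [nth _ _ _]/=; evaluate => //; rewrite -/Z; lia.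
have B0 : x + 1 < Z by lia.
have B1 : 1 < Z by lia.
have B2 : 2 < Z by lia.
have B3 : q + 2 < Z by lia.
have pZ : pointer_off n l q < Z by lia.
have cZ : chunk_off n l q < Z by lia.
have dZ : (data_size n l q E).+1 < Z by lia.
have YZ : Y < Z by lia.
have w1 : 1 < w by lia.
have ll0 : 0 < l * l by rewrite muln_gt0; lia.
have jn : j < n by apply: leq_ltn_trans jx xn.
pose i := x %/ (2 * q); pose p := x %% (2 * q).
have r19 : r 19 = i by rewrite (re 14 isT) [nth _ _ _]/=; evaluate.
have r20 : r 20 = p by rewrite (re 15 isT) [nth _ _ _]/=; evaluate.
have iG : i < n %/ (2 * q) + 1 by rewrite addn1 ltnS leq_div2r // ltnW.
have ji : j < 2 * q * i.+1.
  by apply: leq_ltn_trans jx _; rewrite mulnC ltn_ceil // muln_gt0.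
have ltF t : t < q + 2 ->
  record_off n l + ((q + 2) * (q * i * i.+1 + j) + t) < pointer_off n l q.
  by move=> tq; rewrite ltn_add2l record_index_lt.
pose fa := record_off n l + (q + 2) * (q * i * i.+1 + j).
have ltfa t : t < q + 2 -> fa + t < pointer_off n l q by rewrite -addnA; apply: ltF.
have fa0 := ltfa 0 (ltn_addl q (isT : 0 < 2)).
have r21 : r 21 = fa.
  have B4 : i + 1 < Z by apply: leq_ltn_trans B0; rewrite leq_add2r leq_div.
  have B5 : fa < Z by rewrite -[fa]addn0; apply: ltn_trans fa0 pZ.
  rewrite /fa -(addn1 i) in B5 *.
  (* The intermediate results are dominated by the address, so its bound excludes overflow in each
     of them. *)
  have B6 : (q + 2) * (q * i * (i + 1) + j) < Z by apply: leq_ltn_trans B5; apply: leq_addl.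
  have B7 : q * i * (i + 1) + j < Z by apply: leq_ltn_trans B6; rewrite leq_pmull // addn2.
  have B8 : q * i * (i + 1) < Z by apply: leq_ltn_trans B7; apply: leq_addr.
  have B9 : q * i < Z by apply: leq_ltn_trans B8; rewrite leq_pmulr // addn1.
  by rewrite (re 16 isT) [nth _ _ _]/=; evaluate.
have recP t : t < q + 2 -> nth false D (fa + t) = code i j t.
  by move=> tq; rewrite -addnA layout_record.
have r22 : r 22 = code i j 0.
  rewrite -recP ?addn2 // -bitval1 (re 17 isT) [nth _ _ _]/= addn0.
  by evaluate => //; apply: leq_ltn_trans pZ; rewrite -[fa]addn0.
have r23 : r 23 = (p %/ q == code i j 0) by rewrite (re 18 isT) [nth _ _ _]/=; evaluate.
pose t := if p %/ q == code i j 0 then 2 + p %% q else 1.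
have pq : 2 + p %% q < q + 2 by rewrite addnC ltn_add2r ltn_pmod.
have tq : t < q + 2 by rewrite /t; case: ifP => _ //; rewrite addn2.
have r24 : r 24 = t.
  rewrite (re 19 isT) [nth _ _ _]/=.
  apply: eval_select; evaluate => //; first exact: ltn_trans pq B3.
  exact: ltn_trans tq B3.
have ltft := ltfa t tq.
have r25 : r 25 = decode q code x j.
  rewrite /decode -/i -/p -/t -recP // -bitval1 (re 20 isT) [nth _ _ _]/=.
  by evaluate => //; [apply: ltn_trans pZ | apply: leq_ltn_trans pZ].
pose idx := x * n + j.
have idxn : idx < n * n.
  apply: leq_trans (_ : x.+1 * n <= _); last by rewrite leq_mul2r xn orbT.
  by rewrite /idx mulSn addnC ltn_add2r.
have nnY : n * n <= Y.
  apply: leq_trans (leq_mul nl nl) _; rewrite -expnD leq_exp2l // addnn -mul2n.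
  by rewrite leq_mul2r orbT.
have idxZ : idx < Z by apply: ltn_trans YZ; apply: leq_trans nnY.
have r26 : r 26 = idx.
  rewrite (re 21 isT) [nth _ _ _]/= /idx; evaluate => //.
  by apply: leq_ltn_trans idxZ; apply: leq_addr.
have llY : l * l <= Y by apply: leq_trans nnY; rewrite leq_mul // ltnW.
have r27 : r 27 = l * l.
  by rewrite (re 22 isT) [nth _ _ _]/=; evaluate => //; apply: leq_ltn_trans YZ.
pose k := idx %/ (l * l); pose u := idx %% (l * l).
have kN : k < n * n %/ (l * l) + 1 by rewrite addn1 ltnS leq_div2r // ltnW.
have uk : u < l * l by rewrite ltn_pmod.
have ltP : pointer_off n l q + 8 * l * k < chunk_off n l q.
  rewrite ltn_add2l [ltnRHS]mulnC ltn_mul2l kN andbT muln_gt0 /=.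
  exact: leq_trans q0 ql.
have r28 : r 28 = pointer n l q E k.
  rewrite -(layout_pointer pos rk code E n3 ln l2 q0 ql nl kN) (re 23 isT) [nth _ _ _]/=.
  evaluate => //; first by apply: leq_ltn_trans (ltn_trans ltP cZ); apply: leq_addl.
    exact: ltn_trans ltP cZ.
  exact: leq_ltn_trans ltP cZ.
have ltC : pointer n l q E k + u < data_size n l q E.
  by apply: leq_trans (pointer_le q E kN); rewrite ltn_add2l.
have r29 : r 29 = E idx.
  have -> : idx = l * l * k + u by rewrite mulnC -divn_eq.
  rewrite -(layout_chunk pos rk code E n3 ln l2 q0 ql nl kN uk) -bitval1 (re 24 isT) [nth _ _ _]/=.
  evaluate => //; first exact: ltn_trans ltC (ltnW dZ).
  by apply: leq_ltn_trans (ltnW dZ).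
have r30 : r 30 = (decode q code x j != E idx) && (rk a <= rk b).
  have e1 := eval_not w0 (eval_eq (e1 := Var 25) (e2 := Var 29) (m := packed w D) r25 r29).
  have e2 := eval_not w0 (eval_lt (e1 := Var 14) (e2 := Var 13) (m := packed w D) r14 r13).
  rewrite (re 25 isT) [nth _ _ _]/= leqNgt.
  have <- : ((decode q code x j : nat) != E idx) * ~~ (rk b < rk a)
          = (decode q code x j != E idx) && ~~ (rk b < rk a).
    by rewrite mulnb; case: decode; case: (E idx).
  apply: eval_mul => //.
  by do 2 case: (~~ _); rewrite ?mul0n ?muln0 //; apply: ltnW.
(* The last selection takes register 30, whatever register 33 holds. *)
have n2 : (n == 2) = false by apply/negbTE; rewrite neq_ltn n3 orbT.
rewrite (re 29 isT) [nth _ _ _]/= -r30.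
have -> : r 30 = if n == 2 then r 33 else r 30 by rewrite n2.
apply: eval_select; evaluate => //.
by rewrite n2 r30; case: (_ && _); rewrite // ltnW.
Qed.

End Query.

(** * Two elements *)

Lemma packed_small w D : 0 < w -> size D <= 1 -> packed w D 0 = nth false D 0.
Proof.
case: w => // w _ sD; rewrite /packed big_ord_recl muln1 big1 ?addn0 // => j _.
by rewrite nth_default // (leq_trans sD).
Qed.

(** Registers 31 to 33 compute the answer; register 30 may hold anything, since the final selection
    multiplies it by 0. *)
Lemma query_two_correct w a b D s : 2 <= w -> a <= 2 -> b <= 2 -> size D <= 1 ->
  s = iter (size query_program) (step w query_program) (query_state w 2 D a b) ->
  [/\ halted query_program s, Defs.mem s = packed w D &
      regs s 0 = (a == b) || (size D == 1) && ((a < b) == nth false D 0)].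
Proof.
move=> w2 a2 b2 sD /query_programP[r [hs ms r0 ri re]].
split=> //; rewrite {}r0 {hs ms s}.
have w0 : 0 < w by apply: ltnW.
have wZ : w < 2 ^ w by rewrite ltn_expl.
have Z2 : 2 < 2 ^ w by apply: leq_ltn_trans wZ.
have Z1 : 1 < 2 ^ w by apply: ltnW.
have r0 : r 0 = a by rewrite ri // modn_small //=; apply: leq_ltn_trans Z2.
have r1 : r 1 = b by rewrite ri // modn_small //=; apply: leq_ltn_trans Z2.
have r2 : r 2 = 2 by rewrite ri // modn_small.
have r4 : r 4 = size D by rewrite ri // modn_small //=; apply: leq_ltn_trans Z1.
have r31 : r 31 = (a == b) by rewrite (re 26 isT) [nth _ _ _]/=; evaluate.
have ld : eval w (packed w D) r (Deref (Cst 0)) = nth false D 0.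
  by rewrite /= mod0n packed_small.
have r32 : r 32 = (size D == 1) && ((a < b) == nth false D 0).
  rewrite (re 27 isT) [nth _ _ _]/=.
  have <- : (size D == 1) * ((a < b : nat) == nth false D 0)
     = (size D == 1) && ((a < b) == nth false D 0).
    by rewrite mulnb; case: (a < b); case: nth.
  evaluate => //.
  by do 2 case: (_ == _); rewrite ?mul0n ?muln0 //; apply: ltnW.
have r33 : r 33 = if a == b then 1 else r 32.
  rewrite (re 28 isT) [nth _ _ _]/=.
  apply: eval_select; evaluate => //.
  by rewrite r32; case: ifP => // _; case: (_ && _) => //; apply: ltnW.
have r34 : r 34 = r 33.
  have e2 : eval w (packed w D) r (Bin CmpEq (Var 2) (Cst 2)) = (2 == 2) by evaluate.
  rewrite (re 29 isT) [nth _ _ _]/=; apply: (eval_select (b := true) (y := r 30)) => //.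
  by rewrite r33 r32; case: ifP => // _; case: (_ && _) => //; apply: ltnW.
by rewrite r34 r33 r32; case: (a == b).
Qed.

(** The empty string stands for the antichain; a single bit tells whether the order agrees with that
    of the labels. *)
Lemma encode_two (d : Order.disp_t) (S : finPOrderType d) (lab : S -> nat) :
  labelling 2 lab ->
  exists D : seq bool, size D <= 1 /\
    forall a b : S, (a <= b)%O =
      (lab a == lab b) || (size D == 1) && ((lab a < lab b) == nth false D 0).
Proof.
move=> [labI labP].
pose up := [exists x, exists y, (x < y)%O && (lab x < lab y)].
pose dn := [exists x, exists y, (x < y)%O && (lab y < lab x)].
exists (if up then [:: true] else if dn then [:: false] else [::]).
split; first by case: up; case: dn.
move=> a b; rewrite (inj_eq labI) le_eqVlt; case: eqVneq => //= ab.
have lab_eq x y k : lab x = k -> lab y = k -> x = y by move=> <- /labI.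
have nab : lab a <> lab b by move/labI/eqP; apply/negP.
have := labP a; have := labP b => lb la.
have pick x y : lab x < lab y -> lab x = 1 /\ lab y = 2.
  by have := labP x; have := labP y; lia.
case: (ltnP (lab a) (lab b)) => hab.
  have [a1 b2] := pick _ _ hab.
  case: (boolP up) => /= [/existsP[x /existsP[y /andP[xy /pick[x1 y2]]]]|nup].
    by rewrite (lab_eq _ _ _ a1 x1) (lab_eq _ _ _ b2 y2) xy.
  have -> : (a < b)%O = false.
    by apply: contraNF nup => ltab; apply/existsP; exists a; apply/existsP; exists b; rewrite ltab.
  by case: (boolP dn).
have hba : lab b < lab a by lia.
have [b1 a2] := pick _ _ hba.
case: (boolP up) => /= [/existsP[x /existsP[y /andP[xy /pick[x1 y2]]]]|nup].
  by rewrite (lab_eq _ _ _ a2 y2) (lab_eq _ _ _ b1 x1) lt_gtF.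
case: (boolP dn) => /= [/existsP[x /existsP[y /andP[xy /pick[y1 x2]]]]|ndn].
  by rewrite (lab_eq _ _ _ a2 x2) (lab_eq _ _ _ b1 y1) xy.
by apply: contraNF ndn => ltab; apply/existsP; exists a; apply/existsP; exists b; rewrite ltab.
Qed.

(** * Choice of the parameters *)

Lemma ffact_ge (m q : nat) : (m - q) ^ q <= m ^_ q.
Proof.
rewrite ffact_prod -[X in _ ^ X](card_ord q) -prod_nat_const; apply: leq_prod => i _.
by apply: leq_sub2l; apply: ltnW.
Qed.

(** From [2 * q <= e] follows [n <= 2 * P * (e.+1 - q)], which reduces the claim to
    [q * (2 * P) ^ q <= e]. *)
Lemma biclique_condition (n l k q : nat) :
  2 ^ l.-1 < n -> 0 < k -> l <= 2 ^ k -> 16 * k <= l -> q = l %/ (12 * k) ->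
  q * n ^ q <= (n %/ 2 ^ (5 * k)) * ((n %/ 2 ^ (5 * k)).+1 ^_ q).
Proof.
move=> ln k0 lk kl qE; set P := 2 ^ (5 * k); set e := n %/ P.
have q0 : 0 < q by rewrite qE divn_gt0; lia.
have ql : 12 * k * q <= l by rewrite qE mulnC leq_trunc_div.
have P0 : 0 < P by rewrite expn_gt0.
have qk : q <= 2 ^ k.
  apply: leq_trans lk; apply: leq_trans ql.
  by rewrite leq_pmull // muln_gt0.
have kq : k <= k * q by rewrite leq_pmulr.
have qe : q * 2 ^ ((5 * k + 1) * q) <= e.
  rewrite leq_divRL // -mulnA.
  apply: leq_trans (ltnW ln).
  apply: leq_trans (_ : 2 ^ k * (2 ^ ((5 * k + 1) * q) * P) <= _).
    by rewrite leq_mul2r qk orbT.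
  rewrite -!expnD leq_exp2l //.
  (* The total exponent is at most [6 * k * q + 6 * k <= l / 2 + 3 * l / 8], hence at most [l - 1]
     as [l >= 16]. *)
  have : (5 * k + 1) * q <= 6 * (k * q).
    by rewrite mulnA leq_mul2r; apply/orP; right; lia.
  by move: ql; rewrite -mulnA; lia.
have e2 : 2 * q <= e.
  apply: leq_trans qe; rewrite mulnC leq_mul2l; apply/orP; right.
  rewrite -{1}(expn1 2) leq_exp2l // muln_gt0 q0 andbT; lia.
have ne : n <= 2 * P * (e.+1 - q).
  apply: leq_trans (ltnW (ltn_ceil n P0)) _; rewrite -/e mulnC -mulnA [2 * _]mulnC -mulnA.
  by rewrite leq_mul2l; apply/orP; right; lia.
apply: leq_trans (_ : q * ((2 * P) ^ q * (e.+1 - q) ^ q) <= _).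
  by rewrite leq_mul2l -expnMn leq_exp2r // ne orbT.
rewrite mulnA; apply: leq_mul; last exact: ffact_ge.
by rewrite /P -expnS -expnM -(addn1 (5 * k)).
Qed.

(** For [k >= 8] one has [16 * k <= 2 ^ k.-1], so the hypotheses force [k <= 7]. *)
Lemma lg_small (l k : nat) : 2 ^ k.-1 < l -> l < 16 * k -> l < 112.
Proof.
move=> kl lk; case: (leqP k 7) => k7; first by lia.
suff : 16 * k <= 2 ^ k.-1 by lia.
have H m : 16 * (8 + m) <= 2 ^ (7 + m).
  by elim: m => // m IH; rewrite !addnS expnS; lia.
have := H (k - 8); have -> : 8 + (k - 8) = k by lia.
by have -> : 7 + (k - 8) = k.-1 by lia.
Qed.

Lemma sparse_encoding : exists C : nat,
  forall (d : Order.disp_t) (S : finPOrderType d), 3 <= #|S| ->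
  let n := #|S| in let l := lg n in
  exists (q : nat) (s : seq S) (code : nat -> nat -> nat -> bool),
    [/\ 0 < q <= l, l <= 24 * lg l * q, uniq s, s =i S &
        (\sum_(x < n) mismatch q code (nth_cmp s) x) * l ^ 3 <= C * n ^ 2].
Proof.
(* [112 ^ 3] serves small [l], where every pair may be an error; 11 is the sum [1 + 4 + 4 + 2] of
   the coefficients in [encode_poset]. *)
exists (112 ^ 3 + 11) => d S n3 n l; set k := lg l.
have n1 : 1 < n by apply: ltnW.
have /andP[ln nl] : 2 ^ l.-1 < n <= 2 ^ l by apply: up_log_bounds.
have l2 : 1 < l by move: nl; case: (l) => [|[|?]] //; rewrite /n; lia.
have /andP[kl lk] : 2 ^ k.-1 < l <= 2 ^ k by apply: up_log_bounds.
have k0 : 0 < k by rewrite up_log_gt0.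
case: (leqP (16 * k) l) => kl16; last first.
  exists 1, (enum S), (fun _ _ _ => false); split.
  - exact: ltnW l2.
  - by lia.
  - exact: enum_uniq.
  - exact: mem_enum.
  rewrite mulnC; apply: leq_mul.
    apply: leq_trans (leq_addr _ _); rewrite leq_exp2r //.
    exact: ltnW (lg_small kl kl16).
  apply: leq_trans (_ : \sum_(x < n) n <= _); last by rewrite sum_nat_const card_ord mulnn.
  apply: leq_sum => x _; apply: leq_trans (_ : \sum_(j < x.+1) 1 <= _).
    by apply: leq_sum => j _; apply: leq_b1.
  by rewrite sum_nat_const card_ord muln1.
have k4 : k * 4 <= l.-1 by lia.
have k12 : 12 * k <= l by lia.
have k0' : 0 < 12 * k by lia.
pose q := l %/ (12 * k); pose e := n %/ 2 ^ (5 * k).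
have hq := biclique_condition ln k0 lk kl16 (erefl q).
have q0 : 0 < q by rewrite divn_gt0.
have ql : q <= l by apply: leq_div.
have [s [code [us sS hs]]] := encode_poset q0 hq.
exists q, s, code; split=> //.
- by rewrite q0.
(* Rounding down at most halves the quotient, as [q + 1 <= 2 * q]; hence 24 instead of 12. *)
- apply: leq_trans (ltnW (ltn_ceil l k0')) _; rewrite -/q -/k mulnC.
  rewrite -[24]/(12 * 2) -!mulnA [2 * _]mulnCA !leq_mul2l /= mul2n -addnn.
  by rewrite -addn1 leq_add2l q0 orbT.
apply: leq_trans (_ : 11 * n ^ 2 <= _); last by rewrite leq_mul2r leq_addl orbT.
apply: leq_trans (leq_mul hs (leqnn (l ^ 3))) _; rewrite -/n -/e.
(* As [l <= 2 ^ k], [e] is at most [n / l ^ 5]; the factor [q * q <= l ^ 2] in the error bound still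
   leaves [l ^ 3]. *)
have el : e * l ^ 5 <= n.
  apply: leq_trans (leq_trunc_div n (2 ^ (5 * k))); rewrite leq_mul2l.
  by rewrite mulnC expnM leq_exp2r // lk orbT.
have el3 : e * l ^ 3 <= n.
  apply: leq_trans el; rewrite leq_mul2l leq_exp2l // orbT //.
have qe : q * q * e * l ^ 3 <= n.
  apply: leq_trans el; rewrite [q * q * e]mulnC -mulnA (expnD l 2 3) -mulnn.
  by rewrite !leq_mul.
have l4 : l ^ 4 <= n.
  apply: leq_trans (ltnW ln); apply: leq_trans (_ : (2 ^ k) ^ 4 <= _); first by rewrite leq_exp2r.
  by rewrite -expnM leq_exp2l.
have ql3 : q * l ^ 3 <= n by apply: leq_trans l4; rewrite expnS leq_mul2r ql orbT.
have l3 : l ^ 3 <= n by apply: leq_trans ql3; rewrite leq_pmull.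
rewrite -mulnA -mulnn [leqRHS]mulnCA leq_mul2l; apply/orP; right.
rewrite 3!mulnDl -!(mulnA 4); move: qe ql3 el3 l3.
by move: (q * q * e * l ^ 3) (q * l ^ 3) (e * l ^ 3) (l ^ 3) => x1 x2 x3 x4; clear; lia.
Qed.

Lemma lg_sqr_le (l : nat) : l * l <= 2 * 2 ^ l.
Proof.
case: (leqP l 3) => l3; first by case: l l3 => [|[|[|[|]]]].
rewrite -(subnKC l3); elim: (l - 4) => // m IH; rewrite addnS expnS; lia.
Qed.

(** The factor [4 * l] clears denominators. The [q] listed bits of the records give the main term
    [l * n ^ 2]; the two other bits add a fraction [2 / q], of order [k / l]. The hypothesis with
    [C] bounds the chunks, and the rest is of order [n ^ 2]. *)
Lemma data_size_bound (n l k q C : nat) (E : pred nat) :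
  3 <= n -> 2 <= l < n -> n <= 2 ^ l -> 2 ^ l.-1 < n -> 0 < k -> 0 < q <= l ->
  l <= 24 * k * q -> (forall i, E i -> i < n * n) ->
  count E (iota 0 (n * n)) * l ^ 3 <= C * n ^ 2 ->
  4 * l * (data_size n l q E + n) <= l * n ^ 2 + 4 * (C + 400) * (n ^ 2 * k).
Proof.
move=> n3 /andP[l2 ln] nl nl' k0 /andP[q0 ql] lkq EP hM.
have ll : l * l <= 4 * n.
  apply: leq_trans (lg_sqr_le l) _; rewrite -{1}(prednK (ltnW l2)) expnS; lia.
set cnt := count _ _ in hM.
have hc : size (chunks (l * l) E (n * n %/ (l * l) + 1)) <= cnt.+1.
  by apply: size_chunks => //; rewrite muln_gt0 (ltnW l2).
rewrite /data_size /chunk_off /pointer_off /record_off /rank_off.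
move: hc; set c := size _; move=> hc.
set G := n %/ (2 * q) + 1; set N := n * n %/ (l * l) + 1.
have hN : l * l * N <= n * n + l * l.
  by rewrite mulnDr muln1 leq_add2r mulnC leq_trunc_div.
have hG : 2 * q * G <= n + 2 * q.
  by rewrite mulnDr muln1 leq_add2r mulnC leq_trunc_div.
clearbody G N c cnt; rewrite -!mulnn in hM *.
have n2k : n * n <= n * n * k by rewrite leq_pmulr.
have nn : 3 * n <= n * n by rewrite leq_mul2r n3 orbT.
have ln2 : l * n <= n * n by rewrite leq_mul2r ltnW ?orbT.
have h1 : l * l * n <= 4 * (n * n) by rewrite mulnA leq_mul2r ll orbT.
have h2 : l * l * l <= 4 * (n * n).
  by apply: leq_trans h1; rewrite leq_mul2l (ltnW ln) orbT.
have h3 : l * (l * l * c) <= C * (n * n) + 4 * (n * n).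
  apply: leq_trans (_ : l * l * l * cnt.+1 <= _).
    by rewrite mulnA mulnA leq_mul2l hc orbT.
  by rewrite mulnS; move: hM; rewrite !expnS expn0 muln1 mulnA [cnt * _]mulnC; lia.
have h4 : l * (N * (8 * l)) <= 8 * (n * n) + 8 * (l * l) by lia.
pose T := 4 * (q * G * G.+1).
have hT : q * T <= n * n + 6 * (n * q) + 8 * (q * q).
  have -> : q * T = (2 * q * G) * (2 * q * G + 2 * q) by rewrite /T; lia.
  apply: leq_trans (leq_mul hG (_ : _ <= n + 4 * q)) _; lia.
have nq : n * q <= n * n by rewrite leq_mul2l (leq_trans ql (ltnW ln)) orbT.
have qq : q * q <= n * q by rewrite leq_mul2r (leq_trans ql (ltnW ln)) orbT.
have h5 : l * (q * T) <= l * (n * n) + 56 * (n * n).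
  apply: leq_trans (leq_mul (leqnn l) hT) _; rewrite !mulnDr.
  have : l * (n * q) <= 4 * (n * n).
    apply: leq_trans h1; rewrite -mulnA leq_mul2l [l * n]mulnC leq_mul2l ql !orbT //.
  have : l * (q * q) <= 4 * (n * n).
    by apply: leq_trans h2; rewrite -mulnA leq_mul2l leq_mul ?orbT.
  lia.
(* Here [1 / q] is traded for [24 * k / l]; [360 = 24 * 15], where [15 = 1 + 6 + 8] comes from
   [hT]. *)
have h6 : l * T <= 360 * (n * n * k).
  apply: leq_trans (leq_mul lkq (leqnn T)) _.
  rewrite -mulnA; apply: leq_trans (_ : 24 * k * (15 * (n * n)) <= _); last by lia.
  rewrite leq_mul2l; apply/orP; right; lia.
have -> : (q + 2) * (q * G * G.+1) = q * (q * G * G.+1) + 2 * (q * G * G.+1) by rewrite mulnDl.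
have Cn : C * (n * n) <= C * (n * n * k) by rewrite leq_mul2l n2k orbT.
move: h5 h6; rewrite /T; lia.
Qed.

(** * Assembly *)

Section Representation.

Variables (d : Order.disp_t) (S : finPOrderType d).

Definition rank (x : S) : nat := #|[set y | (y < x)%O]|.

Lemma rank_lt_card x : rank x < #|S|.
Proof.
rewrite -cardsT; apply: proper_card; apply/properP; split; first exact: subsetT.
by exists x; rewrite !inE ?ltxx.
Qed.

(** The rank is strictly increasing, so it orients every comparable pair. *)
Lemma le_rank a b : (a <= b)%O = (a >=< b)%O && (rank a <= rank b).
Proof.
have lt x y : (x < y)%O -> rank x < rank y.
  move=> xy; apply: proper_card; apply/properP; split; last by exists x; rewrite !inE ?ltxx.
  by apply/subsetP => z; rewrite !inE => /lt_trans; apply.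
rewrite /Order.comparable; case: (boolP (a <= b)%O) => [ab|nab] /=.
  by move: ab; rewrite le_eqVlt => /orP[/eqP-> | /lt/ltnW->] //; rewrite leqnn.
case: (boolP (b <= a)%O) => //= ba; apply/esym/negbTE; rewrite -ltnNge; apply: lt.
by rewrite lt_neqAle ba andbT; apply: contraNneq nab => ->.
Qed.

Variable lab : S -> nat.
Hypothesis labP : labelling #|S| lab.

(** A table needs a value at every number; the default 0 keeps all entries below [n]. *)
Definition at_label (f : S -> nat) (m : nat) : nat :=
  if [pick x | lab x == m] is Some x then f x else 0.

Lemma at_labelE f a : at_label f (lab a) = f a.
Proof.
rewrite /at_label; case: pickP => [x /eqP/labP.1-> //|/(_ a)].
by rewrite eqxx.
Qed.

Lemma at_label_lt f m n : 0 < n -> (forall x, f x < n) -> at_label f m < n.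
Proof. by move=> n0 fn; rewrite /at_label; case: pickP. Qed.

Variables (q : nat) (code : nat -> nat -> nat -> bool) (s : seq S).
Hypotheses (us : uniq s) (sS : s =i S).

(** Restricted to the lower triangle, so that its ones are exactly the mismatches; the bound on [i]
    gives the finite support that [size_chunks] requires. *)
Definition correction (i : nat) : bool :=
  let x := i %/ #|S| in let j := i %% #|S| in
  [&& i < #|S| * #|S|, j <= x & nth_cmp s x j != decode q code x j].

Lemma correctionE x j : x < #|S| -> j < #|S| ->
  correction (x * #|S| + j) = (j <= x) && (nth_cmp s x j != decode q code x j).
Proof.
move=> xn jn; rewrite /correction divnMDl ?(leq_ltn_trans _ jn) // modnMDl.
rewrite (divn_small jn) (modn_small jn) addn0.
have -> // : x * #|S| + j < #|S| * #|S|.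
apply: leq_trans (_ : x.+1 * #|S| <= _); last by rewrite leq_mul2r xn orbT.
by rewrite mulSn addnC ltn_add2r.
Qed.

Lemma count_correction :
  count correction (iota 0 (#|S| * #|S|)) =
  \sum_(x < #|S|) mismatch q code (nth_cmp s) x.
Proof.
rewrite count_iota_mul; apply: eq_bigr => x _.
rewrite /mismatch.
rewrite (big_ord_widen _ (fun j => nth_cmp s x j != decode q code x j : nat)
  (ltn_ord x)) [RHS]big_mkcond /=.
by apply: eq_bigr => j _; rewrite correctionE // ltnS; case: (j <= x).
Qed.

Lemma size_enumeration : size s = #|S|.
Proof. by rewrite -(card_uniqP us) (eq_card sS). Qed.

Lemma index_lt a : index a s < #|S|.
Proof. by rewrite -size_enumeration index_mem sS. Qed.

Lemma decode_correction a b :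
  let x := maxn (index a s) (index b s) in
  let j := minn (index a s) (index b s) in
  (decode q code x j != correction (x * #|S| + j)) = (a >=< b)%O.
Proof.
move=> x j; have ia := index_lt a; have ib := index_lt b.
have xn : x < #|S| by rewrite gtn_max ia.
have jn : j < #|S| by rewrite gtn_min ia.
have jx : j <= x by rewrite geq_min leq_max leqnn.
rewrite correctionE // jx /=.
have -> : (a >=< b)%O = nth_cmp s x j.
  rewrite (nth_cmpE a) ?size_enumeration // /x /j /maxn /minn.
  by case: ifP => _; rewrite !nth_index ?sS // comparable_sym.
by case: nth_cmp; case: decode.
Qed.

End Representation.

(** * The bound over the reals and the theorem *)

Local Open Scope ring_scope.

Lemma size_real_bound (R : realType) (n l k C z : nat) : (0 < l)%N ->
  (4 * l * z <= l * n ^ 2 + 4 * C * (n ^ 2 * k))%N ->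
  z%:R <= n%:R ^+ 2 / 4%:R + C%:R * ((n%:R ^+ 2 * k%:R) / l%:R) :> R.
Proof.
move=> l0 h.
have l0' : l%:R != 0 :> R by rewrite pnatr_eq0 -lt0n.
have -> : n%:R ^+ 2 / 4%:R + C%:R * ((n%:R ^+ 2 * k%:R) / l%:R)
    = (l * n ^ 2 + 4 * C * (n ^ 2 * k))%:R / (4 * l)%:R :> R.
  by rewrite natrD !natrM; field; rewrite l0'.
rewrite ler_pdivlMr; last by rewrite ltr0n muln_gt0.
by rewrite -natrM ler_nat mulnC.
Qed.

Unset Implicit Arguments.

Theorem theorem1 (R : realType) :
  exists (c : R) (k : nat), 0 < c /\ (0 < k)%N /\
  forall K : nat, (k <= K)%N ->
  exists (p : program) (t : nat),
  forall n w : nat, (2 <= n)%N -> (k * lg n <= w <= K * lg n)%N ->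
  forall (d : Order.disp_t) (S : finPOrderType d) (lab : S -> nat),
    #|S| = n -> labelling n lab ->
  exists D : seq bool,
    (size D)%:R <= n%:R ^+ 2 / 4%:R
                   + c * ((n%:R ^+ 2 * (lg (lg n))%:R) / (lg n)%:R) /\
    supports_precedence lab w p t D.
Proof.
have [C sparse] := sparse_encoding.
(* Words of [9 * lg n] bits hold addresses of [8 * lg n] bits with room to spare. *)
exists (C + 400)%:R, 9; split; first by rewrite ltr0n addn_gt0 orbT.
split=> // K _; exists query_program, (size query_program).
move=> n w n2 /andP[lw _] d S lab nS labP; subst n.
move: n2; rewrite leq_eqVlt => /orP[/eqP S2|n3].
  move: lw labP; rewrite -S2 => lw labP.
  have w2 : (2 <= w)%N by apply: leq_trans lw.
  have [D [sD DP]] := encode_two labP.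
  exists D; split.
    (* The main term [2 ^ 2 / 4 = 1] alone pays for the single bit. *)
    rewrite -[X in X <= _]addr0; apply: lerD; last by rewrite !mulr_ge0 ?invr_ge0 ?exprn_ge0.
    have -> : 2%:R ^+ 2 / 4%:R = 1 :> R by field.
    by rewrite lern1.
  move=> a b s; have /andP[_ la] := labP.2 a; have /andP[_ lb] := labP.2 b.
  have sE : s = iter (size query_program) (step w query_program)
                  (query_state w 2 D (lab a) (lab b)) by rewrite /s -S2.
  clearbody s; have [hs ms rs] := query_two_correct w2 la lb sD sE.
  by clear sE; split; [exact: hs | rewrite rs DP | move=> i; rewrite ms].
have [q [s [code [/andP[q0 ql] lq us sS hM]]]] := sparse d S n3.
move: q0 ql lq hM; set n := #|S|; set l := lg n => q0 ql lq hM.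
have /andP[ln nl] : (2 ^ l.-1 < n <= 2 ^ l)%N by apply: up_log_bounds => //; apply: ltnW.
have l2 : (1 < l)%N by move: nl; case: (l) => [|[|?]] //; rewrite /n; lia.
have lltn : (l < n)%N.
  apply: leq_ltn_trans ln; rewrite -{1}(prednK (ltnW l2)); exact: ltn_expl.
have n0 : (0 < n)%N by apply: leq_trans n3.
pose pos := at_label lab (index^~ s); pose rk := at_label lab (@rank d S).
pose E := correction q code s.
have posP m : (pos m < n)%N by apply: at_label_lt => // x; apply: index_lt.
have rkP m : (rk m < n)%N by apply: at_label_lt => // x; apply: rank_lt_card.
have hE i : E i -> (i < n * n)%N by case/andP.
rewrite -count_correction in hM.
have sz := @data_size_bound n l (lg l) q C E n3 _ nl ln _ _ lq hE hM.
exists (layout n l q pos rk code E); split.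
  apply: size_real_bound; first exact: ltnW.
  apply: leq_trans (sz _ _ _); rewrite ?l2 ?q0 ?up_log_gt0 //.
  by rewrite leq_mul2l size_layout_le ?orbT.
move=> a b z; have /andP[_ la] := labP.2 a; have /andP[_ lb] := labP.2 b.
have zE : z = iter (size query_program) (step w query_program)
  (query_state w n (layout n l q pos rk code E) (lab a) (lab b)) by rewrite /z.
clearbody z.
have [hz mz rz] := query_correct n3 lltn l2 q0 ql nl posP rkP lw la lb zE.
clear zE; split; [exact: hz | rewrite rz | by move=> i; rewrite mz].
rewrite /pos /rk !at_labelE // le_rank; congr (nat_of_bool (_ && _)).
exact: decode_correction.
Qed.
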